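(* Let $B$ be an $n$-dimensional manifold with corners, $\pi_P:P\to B$ a principal $SL_n(\mathbb Z)$-bundle, and $\{X,\nu,\mu\}$ a $2n$-dimensional twisted toric manifold associated with $P$. Let $b$ be a point in the interior of $B$, let $y_0\in\pi_T^{-1}(b)$ and $x_0=\nu(y_0)\in X$. If $B$ has at least one corner point, i.e. $\mathcal S^{(0)}B\neq\emptyset$, then $\mu:X\to B$ induces an isomorphism $\mu_*:\pi_1(X,x_0)\cong\pi_1(B,b)$.
   Context: Conventions: all manifolds are compact, connected and oriented and all maps preserve orientations unless otherwise stated. $T^n=\mathbb R^n/\mathbb Z^n$, $\mathfrak t^*$ is identified with $\mathbb R^n$, and $\mathfrak t^*_{\ge0}=\{\xi\in\mathbb R^n:\xi_i\ge0\ \forall i\}$. $D^n_\epsilon(\xi_0)\subset\mathbb R^n$ is the open disc with center $\xi_0$ and radius $\epsilon$. $\mu_{\mathbb C^n}:\mathbb C^n\to\mathfrak t^*_{\ge0}$, $\mu_{\mathbb C^n}(z)=(|z_1|^2,\dots,|z_n|^2)$, and $\nu_{\mathbb C^n}:\mathfrak t^*_{\ge0}\times T^n\to\mathbb C^n$, $\nu_{\mathbb C^n}(\xi,\theta)=(\sqrt{\xi_i}\,e^{2\pi\sqrt{-1}\theta_i})_i$. $\mathfrak t^*_{\ge0}\times T^n$ is oriented by $d\xi_1\wedge d\theta_1\wedge\cdots\wedge d\xi_n\wedge d\theta_n$ and $\mathbb C^n$ by its standard complex orientation. For a principal $SL_n(\mathbb Z)$-bundle $\pi_P:P\to B$, let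 $\pi_T:T^n_P\to B$ be the associated $T^n$-bundle (natural action of $SL_n(\mathbb Z)$ on $T^n$). A local trivialization $\varphi^P$ of $P$ induces a local trivialization $\varphi^T$ of $T^n_P$. Twisted toric manifold associated with $P\to B$: a tuple $\{X,\nu,\mu\}$ with $X$ a $2n$-dimensional manifold and $\nu:T^n_P\to X$, $\mu:X\to B$ surjective maps with $\mu\circ\nu=\pi_T$, such that every $b\in B$ admits a locally toric chart $(U,\varphi^P,\varphi^X,\varphi^B)$: $U$ is an open neighborhood of $b$; $\varphi^B:U\to\mathfrak t^*_{\ge0}\cap D^n_\epsilon(\xi_0)$ is an orientation consistent diffeomorphism with $\varphi^B(b)=\xi_0$ (for some $\xi_0\in\mathfrak t^*_{\ge 0}$, $\epsilon>0$); $\varphi^P:\pi_P^{-1}(U)\cong U\times SL_n(\mathbb Z)$ is a local trivialization; $\varphi^X:\mu^{-1}(U)\to\mu_{\mathbb C^n}^{-1}(D^n_\epsilon(\xi_0))$ is an orientation preserving diffeomorphism; and $\varphi^X\circ\nu=\nu_{\mathbb C^n}\circ(\varphi^B\times\mathrm{id}_{T^n})\circ\varphi^T$ on $\pi_T^{-1}(U)$, $\mu_{\mathbb C^n}\circ\varphi^X=\varphi^B\circ\mu$ on $\mu^{-1}(U)$. Strata: for $b\in B$, $n(b)=\#\{i:\varphi^B(b)_i=0\}$ for any such coordinate $\varphi^B$ near $b$ (independent of the choice), and $\mathcal S^{(k)}B=\{b\in B:n(b)=n-k\}$. A corner point of $B$ is a point of $\mathcal S^{(0)}B$. *)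

(* Defs.v *)
From HB Require Import structures.
From mathcomp Require Import all_boot all_order all_algebra.
From mathcomp Require Import generic_quotient.
From mathcomp Require Import all_classical all_reals all_analysis.
From mathcomp Require Import ring lra.

Set Implicit Arguments.
Unset Strict Implicit.
Unset Printing Implicit Defensive.
Set SsrOldRewriteGoalsOrder.

Import Order.TTheory GRing.Theory Num.Theory.
Import numFieldNormedType.Exports.
Local Open Scope classical_set_scope.
Local Open Scope ring_scope.
Local Open Scope quotient_scope.

Lemma within_continuous_comp (S T U : topologicalType) (A : set S) (B : set T)
    (f : T -> U) (g : S -> T) :
  {within B, continuous f} -> {within A, continuous g} ->
  (forall x, A x -> B (g x)) -> {within A, continuous (f \o g)}.
Proof.
move=> /subspace_continuousP cf /subspace_continuousP cg AB.
apply/subspace_continuousP => x Ax.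
apply: cvg_comp (cf _ (AB _ Ax)) => W /=.
rewrite nbhs_simpl /within/= => gW.
have : nbhs x (fun y => A y -> B (g y) -> W (g y)) := cg x Ax _ gW.
by apply: filterS => y + Ay => /(_ Ay); apply; exact: AB.
Qed.

Lemma within_continuous_glue (S T : topologicalType) (C A B : set S)
    (f : S -> T) :
  closed A -> closed B -> C `<=` A `|` B ->
  {within A `&` C, continuous f} -> {within B `&` C, continuous f} ->
  closed C ->
  {within C, continuous f}.
Proof.
move=> cA cB CAB fA fB cC.
apply: (@continuous_subspaceW _ _ _ ((A `&` C) `|` (B `&` C))).
  by move=> x Cx; case: (CAB _ Cx) => ?; [left|right].
by apply: withinU_continuous => //; exact: closedI.
Qed.

Lemma within_continuous_eq (S T : topologicalType) (A : set S) (f g : S -> T) :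
  (forall x, A x -> f x = g x) ->
  {within A, continuous f} -> {within A, continuous g}.
Proof.
by move=> fg; apply: subspace_eq_continuous => x /set_mem Ax; exact: fg.
Qed.

Lemma continuous_pair (S T U : topologicalType) (f : S -> T) (g : S -> U) :
  continuous f -> continuous g -> continuous (fun z => (f z, g z)).
Proof. by move=> cf cg z; apply: cvg_pair; [exact: cf|exact: cg]. Qed.

Lemma continuous_fst (S T : topologicalType) : continuous (@fst S T).
Proof. by move=> [x y]; exact: cvg_fst. Qed.

Lemma continuous_snd (S T : topologicalType) : continuous (@snd S T).
Proof. by move=> [x y]; exact: cvg_snd. Qed.

Section RealValued.
Variables (R : realType) (S : topologicalType).
Implicit Types f g : S -> R.

Lemma continuous_addr f g : continuous f -> continuous g ->
  continuous (fun z => f z + g z).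
Proof. by move=> cf cg z; apply: cvgD; [exact: cf|exact: cg]. Qed.

Lemma continuous_subr f g : continuous f -> continuous g ->
  continuous (fun z => f z - g z).
Proof. by move=> cf cg z; apply: cvgB; [exact: cf|exact: cg]. Qed.

Lemma continuous_mulr f g : continuous f -> continuous g ->
  continuous (fun z => f z * g z).
Proof. by move=> cf cg z; apply: cvgM; [exact: cf|exact: cg]. Qed.

Lemma continuous_normr f : continuous f -> continuous (fun z => `|f z|).
Proof. by move=> cf z; apply: cvg_norm; exact: cf. Qed.

Lemma continuous_cst (c : R) : continuous (fun _ : S => c).
Proof. by move=> z; exact: cvg_cst. Qed.

End RealValued.

Ltac continuity := repeat first
  [ exact: continuous_fst | exact: continuous_snd | exact: continuous_cst
  | apply: continuous_pair | apply: continuous_subr | apply: continuous_addr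
  | apply: continuous_mulr | apply: continuous_normr
  | (by move=> ?; exact: cvg_id) ].

Section FundamentalGroup.
Variable R : realType.

Notation I01 := (`[0%R : R, 1%R]%classic).

Section Loops.
Variables (T : topologicalType) (x : T).

Record loop := Loop {
  loop_fun :> R -> T;
  loop_cont : {within I01, continuous loop_fun};
  loop0 : loop_fun 0 = x;
  loop1 : loop_fun 1 = x }.

HB.instance Definition _ := gen_eqMixin loop.
HB.instance Definition _ := gen_choiceMixin loop.

(* homotopy relative to the endpoints; the first coordinate is the time *)
Definition loop_homotopic (f g : loop) : Prop := exists H : R * R -> T,
  [/\ {within I01 `*` I01, continuous H},
      forall t, I01 t -> H (0, t) = f t,
      forall t, I01 t -> H (1, t) = g t &
      forall s, I01 s -> H (s, 0) = x /\ H (s, 1) = x].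

Lemma in01 (t : R) : I01 t <-> 0 <= t <= 1.
Proof. by rewrite /= in_itv. Qed.

Lemma closed01 : closed (I01 `*` I01).
Proof.
rewrite (_ : _ `*` _ = fst @^-1` I01 `&` snd @^-1` I01) //.
by apply: closedI; apply: closed_comp; try exact: interval_closed;
  move=> z _; [exact: continuous_fst|exact: continuous_snd].
Qed.

(* a homotopy through reparametrizations of a single loop *)
Lemma homotopic_reparam (h : loop) (psi : R * R -> R) (f g : loop) :
  continuous psi ->
  (forall s t, I01 s -> I01 t -> I01 (psi (s, t))) ->
  (forall t, I01 t -> h (psi (0, t)) = f t) ->
  (forall t, I01 t -> h (psi (1, t)) = g t) ->
  (forall s, I01 s -> h (psi (s, 0)) = x /\ h (psi (s, 1)) = x) ->
  loop_homotopic f g.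
Proof.
move=> cpsi i01 hf hg hx; exists (h \o psi); split => //.
apply: (@within_continuous_comp _ _ _ _ I01); first exact: loop_cont.
  exact: continuous_subspaceT.
by move=> [s t] [/= ? ?]; exact: i01.
Qed.

Lemma loop_homotopic_refl f : loop_homotopic f f.
Proof.
apply: (@homotopic_reparam f snd) => //.
- by continuity.
- by move=> s _; rewrite /= loop0 loop1.
Qed.

Lemma loop_homotopic_sym f g : loop_homotopic f g -> loop_homotopic g f.
Proof.
move=> [H [cH H0 H1 Hx]].
exists (H \o (fun z => (1 - z.1, z.2))); split.
- apply: (@within_continuous_comp _ _ _ _ (I01 `*` I01)) => //.
    by apply: continuous_subspaceT; continuity.
  by move=> [s t] [] /in01 /= ? ?; split => //=; apply/in01; lra.
- by move=> t t01; rewrite /= subr0 H1.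
- by move=> t t01; rewrite /= subrr H0.
- by move=> s /in01 s01 /=; apply: Hx; apply/in01; lra.
Qed.

Lemma closed_lhalf1 : closed [set z : R * R | z.1 <= 2^-1].
Proof.
by apply: (@closed_comp _ _ fst [set y : R | y <= 2^-1]);
  [move=> z _; exact: continuous_fst|exact: closed_le].
Qed.
Lemma closed_rhalf1 : closed [set z : R * R | 2^-1 <= z.1].
Proof.
by apply: (@closed_comp _ _ fst [set y : R | 2^-1 <= y]);
  [move=> z _; exact: continuous_fst|exact: closed_ge].
Qed.
Lemma closed_lhalf2 : closed [set z : R * R | z.2 <= 2^-1].
Proof.
by apply: (@closed_comp _ _ snd [set y : R | y <= 2^-1]);
  [move=> z _; exact: continuous_snd|exact: closed_le].
Qed.
Lemma closed_rhalf2 : closed [set z : R * R | 2^-1 <= z.2].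
Proof.
by apply: (@closed_comp _ _ snd [set y : R | 2^-1 <= y]);
  [move=> z _; exact: continuous_snd|exact: closed_ge].
Qed.

Lemma dblB_continuous : continuous (fun t : R => 2 * t - 1).
Proof.
by continuity.
Qed.

Lemma loop_homotopic_trans f g h :
  loop_homotopic f g -> loop_homotopic g h -> loop_homotopic f h.
Proof.
move=> [H [cH H0 H1 Hx]] [K [cK K0 K1 Kx]].
exists (fun z => if z.1 <= 2^-1 then H (2 * z.1, z.2) else K (2 * z.1 - 1, z.2)).
split.
- apply: (within_continuous_glue closed_lhalf1 closed_rhalf1 _ _ _ closed01).
  + by move=> [s t] _ /=; case: (lerP s 2^-1) => [?|/ltW ?]; [left|right].
  + apply: (@within_continuous_eq _ _ _ (H \o (fun z => (2 * z.1, z.2)))).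
      by move=> z [/= -> _].
    apply: (@within_continuous_comp _ _ _ _ (I01 `*` I01)) => //.
      by apply: continuous_subspaceT; continuity.
    by move=> [s t] /= [? [/in01 ? ?]]; split => //=; apply/in01; lra.
  + apply: (@within_continuous_eq _ _ _ (K \o (fun z => (2 * z.1 - 1, z.2)))).
      move=> [s t] [/= s2 [_ /= t01]]; case: (lerP s 2^-1) => // s2'.
      have -> : s = 2^-1 by lra.
      by rewrite mulfV// subrr K0 // H1.
    apply: (@within_continuous_comp _ _ _ _ (I01 `*` I01)) => //.
      by apply: continuous_subspaceT; continuity.
    by move=> [s t] /= [? [/in01 ? ?]]; split => //=; apply/in01; lra.
- by move=> t t01 /=; rewrite ifT ?mulr0 ?H0//; lra.
- move=> t t01 /=; rewrite ifF ?mulr1; last by apply/negbTE; rewrite -ltNge; lra.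
  have -> : 2 - 1 = 1 :> R by ring.
  exact: K1.
- move=> s /in01 s01 /=; case: ifPn => s2.
    by apply: Hx; apply/in01; lra.
  by apply: Kx; apply/in01; rewrite -ltNge in s2; lra.
Qed.

Let hrel (f g : loop) : bool := `[< loop_homotopic f g >].

Lemma loop_hrel_refl : reflexive hrel.
Proof. by move=> f; apply/asboolP; exact: loop_homotopic_refl. Qed.
Lemma loop_hrel_sym : symmetric hrel.
Proof.
by move=> f g; apply/idP/idP => /asboolP fg; apply/asboolP;
  exact: loop_homotopic_sym.
Qed.
Lemma loop_hrel_trans : transitive hrel.
Proof.
move=> g f h /asboolP fg /asboolP gh; apply/asboolP.
exact: loop_homotopic_trans gh.
Qed.

Definition loop_hequiv :=
  EquivRel hrel loop_hrel_refl loop_hrel_sym loop_hrel_trans.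

Definition pi1 := {eq_quot loop_hequiv}.

HB.instance Definition _ := EqQuotient.on pi1.
HB.instance Definition _ := Choice.on pi1.


Lemma pi1P (f g : loop) : \pi_pi1 f = \pi_pi1 g <-> loop_homotopic f g.
Proof. by split => [/eqmodP/asboolP//|?]; apply/eqmodP/asboolP. Qed.

Definition concat_fun (f g : R -> T) (t : R) : T :=
  if t <= 2^-1 then f (2 * t) else g (2 * t - 1).

Lemma concat_cont (f g : loop) : {within I01, continuous (concat_fun f g)}.
Proof.
apply: (@within_continuous_glue _ _ _ [set t : R | t <= 2^-1] [set t | 2^-1 <= t]).
- exact: closed_le.
- exact: closed_ge.
- by move=> t _ /=; case: (lerP t 2^-1) => [?|/ltW ?]; [left|right].
- apply: (@within_continuous_eq _ _ _ (f \o (fun t => 2 * t))).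
    by move=> t [/= t2 _]; rewrite /concat_fun t2.
  apply: (@within_continuous_comp _ _ _ _ I01); first exact: loop_cont.
    by apply: continuous_subspaceT; continuity.
  by move=> t /= [? /in01 ?]; apply/in01; lra.
- apply: (@within_continuous_eq _ _ _ (g \o (fun t => 2 * t - 1))).
    move=> t [/= t2 _]; rewrite /concat_fun; case: (lerP t 2^-1) => // t2'.
    have -> : t = 2^-1 by lra.
    by rewrite mulfV// subrr loop0 loop1.
  apply: (@within_continuous_comp _ _ _ _ I01); first exact: loop_cont.
    exact: continuous_subspaceT dblB_continuous.
  by move=> t /= [? /in01 ?]; apply/in01; lra.
- exact: interval_closed.
Qed.

Lemma concat0 (f g : loop) : concat_fun f g 0 = x.
Proof. by rewrite /concat_fun mulr0 ifT ?loop0 ?invr_ge0. Qed.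

Lemma concat1 (f g : loop) : concat_fun f g 1 = x.
Proof.
rewrite /concat_fun ifF; last by apply/negbTE; rewrite -ltNge; lra.
have -> : 2 * 1 - 1 = 1 :> R by ring.
by rewrite loop1.
Qed.

Definition concat (f g : loop) : loop :=
  Loop (@concat_cont f g) (concat0 f g) (concat1 f g).

Lemma cst_cont : {within I01, continuous (cst x : R -> T)}.
Proof. by apply: continuous_subspaceT => t; exact: cvg_cst. Qed.

Definition loop_cst : loop := Loop cst_cont erefl erefl.

Definition rev_fun (f : R -> T) (t : R) : T := f (1 - t).

Lemma rev_cont (f : loop) : {within I01, continuous (rev_fun f)}.
Proof.
rewrite (_ : rev_fun f = loop_fun f \o (fun t => 1 - t)) //.
apply: (@within_continuous_comp _ _ _ _ I01).
- exact: loop_cont.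
- by apply: continuous_subspaceT; continuity.
- by move=> t /in01 ?; apply/in01; lra.
Qed.

Lemma rev0 (f : loop) : rev_fun f 0 = x.
Proof. by rewrite /rev_fun subr0 loop1. Qed.
Lemma rev1 (f : loop) : rev_fun f 1 = x.
Proof. by rewrite /rev_fun subrr loop0. Qed.

Definition loop_rev (f : loop) : loop :=
  Loop (@rev_cont f) (rev0 f) (rev1 f).

Lemma concat_homotopic (f f' g g' : loop) :
  loop_homotopic f f' -> loop_homotopic g g' ->
  loop_homotopic (concat f g) (concat f' g').
Proof.
move=> [H [cH H0 H1 Hx]] [K [cK K0 K1 Kx]].
exists (fun z => if z.2 <= 2^-1 then H (z.1, 2 * z.2) else K (z.1, 2 * z.2 - 1)).
split.
- apply: (within_continuous_glue closed_lhalf2 closed_rhalf2 _ _ _ closed01).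
  + by move=> [s t] _ /=; case: (lerP t 2^-1) => [?|/ltW ?]; [left|right].
  + apply: (@within_continuous_eq _ _ _ (H \o (fun z => (z.1, 2 * z.2)))).
      by move=> z [/= -> _].
    apply: (@within_continuous_comp _ _ _ _ (I01 `*` I01)) => //.
      by apply: continuous_subspaceT; continuity.
    by move=> [s t] /= [? [? /in01 ?]]; split => //=; apply/in01; lra.
  + apply: (@within_continuous_eq _ _ _ (K \o (fun z => (z.1, 2 * z.2 - 1)))).
      move=> [s t] [/= s2 [/= s01 _]]; case: (lerP t 2^-1) => // s2'.
      have -> : t = 2^-1 by lra.
      by rewrite mulfV// subrr (Kx _ s01).1 (Hx _ s01).2.
    apply: (@within_continuous_comp _ _ _ _ (I01 `*` I01)) => //.
      by apply: continuous_subspaceT; continuity.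
    by move=> [s t] /= [? [? /in01 ?]]; split => //=; apply/in01; lra.
- move=> t /in01 t01 /=; rewrite /concat_fun; case: ifPn => t2.
    by apply: H0; apply/in01; lra.
  by apply: K0; apply/in01; rewrite -ltNge in t2; lra.
- move=> t /in01 t01 /=; rewrite /concat_fun; case: ifPn => t2.
    by apply: H1; apply/in01; lra.
  by apply: K1; apply/in01; rewrite -ltNge in t2; lra.
- move=> s s01 /=; rewrite ifT ?mulr0 ?invr_ge0// ifF.
    have -> : 2 * 1 - 1 = 1 :> R by ring.
    by split; [exact: (Hx _ s01).1|exact: (Kx _ s01).2].
  by apply/negbTE; rewrite -ltNge; lra.
Qed.

Lemma rev_homotopic (f g : loop) :
  loop_homotopic f g -> loop_homotopic (loop_rev f) (loop_rev g).
Proof.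
move=> [H [cH H0 H1 Hx]].
exists (H \o (fun z => (z.1, 1 - z.2))); split.
- apply: (@within_continuous_comp _ _ _ _ (I01 `*` I01)) => //.
    by apply: continuous_subspaceT; continuity.
  by move=> [s t] [/= ? /in01 ?]; split => //=; apply/in01; lra.
- by move=> t /in01 t01 /=; apply: H0; apply/in01; lra.
- by move=> t /in01 t01 /=; apply: H1; apply/in01; lra.
- by move=> s s01; rewrite /= subr0 subrr (Hx _ s01).1 (Hx _ s01).2.
Qed.

(* f o phi is homotopic to f when phi fixes 0 and 1 *)
Lemma reparam_homotopic (f g : loop) (phi : R -> R) :
  continuous phi -> (forall t, I01 t -> I01 (phi t)) ->
  phi 0 = 0 -> phi 1 = 1 -> (forall t, I01 t -> g t = f (phi t)) ->
  loop_homotopic g f.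
Proof.
move=> cphi phi01 p0 p1 gE.
apply: (@homotopic_reparam f
  (fun z => (1 - z.1) * phi z.2 + z.1 * z.2)).
- continuity.
  by move=> z; apply: (@continuous_comp _ _ _ snd phi); [exact: continuous_snd|exact: cphi].
- move=> s t /in01 s01 /[dup] /phi01 /in01 pt /in01 t01 /=; apply/in01.
  by apply/andP; split; nra.
- by move=> t t01 /=; rewrite subr0 mul1r mul0r addr0 gE.
- by move=> t t01 /=; rewrite subrr mul1r mul0r add0r.
- move=> s s01 /=; rewrite p0 p1 !mulr0 !mulr1 addr0 subrK.
  by rewrite loop0 loop1.
Qed.

Lemma cont_min (f g : R -> R) : continuous f -> continuous g ->
  continuous (fun t => Num.min (f t) (g t)).
Proof. by move=> cf cg t; exact: (@continuous_min _ _ f g t (cf t) (cg t)). Qed.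

Lemma cont_max (f g : R -> R) : continuous f -> continuous g ->
  continuous (fun t => Num.max (f t) (g t)).
Proof. by move=> cf cg t; exact: (@continuous_max _ _ f g t (cf t) (cg t)). Qed.

Lemma cont_affine (a b : R) : continuous (fun t => a * t + b).
Proof.
by continuity.
Qed.

Lemma concat_cstr (f : loop) : loop_homotopic (concat f loop_cst) f.
Proof.
apply: (@reparam_homotopic f _ (fun t => Num.min (2 * t + 0) (0 * t + 1))).
- by apply: cont_min; exact: cont_affine.
- move=> t /in01 t01; apply/in01; rewrite addr0 mul0r add0r.
  by case: (leP (2 * t) 1) => ?; lra.
- by rewrite mulr0 mul0r addr0 add0r min_l.
- by rewrite mul0r add0r min_r //; lra.
- move=> t /in01 t01 /=; rewrite /concat_fun addr0 mul0r add0r.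
  case: (lerP t 2^-1) => t2; first by rewrite min_l //; lra.
  by rewrite min_r ?loop1 //; lra.
Qed.

Lemma concat_cstl (f : loop) : loop_homotopic (concat loop_cst f) f.
Proof.
apply: (@reparam_homotopic f _ (fun t => Num.max (2 * t + -1) (0 * t + 0))).
- by apply: cont_max; exact: cont_affine.
- move=> t /in01 t01; apply/in01; rewrite mul0r add0r.
  by case: (leP (2 * t + -1) 0) => ?; lra.
- by rewrite mulr0 mul0r addr0 add0r max_r // lerN10.
- by rewrite mul0r add0r max_l //; lra.
- move=> t /in01 t01 /=; rewrite /concat_fun mul0r add0r.
  case: (lerP t 2^-1) => t2; first by rewrite max_r ?loop0 //; lra.
  by rewrite max_l //; lra.
Qed.

Lemma concatA_homotopic (f g h : loop) :
  loop_homotopic (concat (concat f g) h) (concat f (concat g h)).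
Proof.
apply: (@reparam_homotopic _ _ (fun t =>
  Num.min (Num.min (2 * t + 0) (1 * t + 4^-1)) (2^-1 * t + 2^-1))).
- apply: cont_min; last exact: cont_affine.
  by apply: cont_min; exact: cont_affine.
- move=> t /in01 t01; apply/in01; rewrite addr0 mul1r.
  case: (leP (2 * t) (t + 4^-1)) => ?;
    by case: (leP _ (2^-1 * t + 2^-1)) => ?; lra.
- rewrite mulr0 mulr0 mulr0 !add0r min_l; last by rewrite min_l ?invr_ge0.
  by rewrite min_l ?invr_ge0.
- rewrite !mulr1 min_r; first by lra.
  by rewrite le_min; apply/andP; split; lra.
- move=> t /in01 t01 /=; rewrite addr0 mul1r.
  set u := Num.min _ _.
  have uE : u = if t <= 2^-1 then if 2 * t <= 2^-1 then 2 * t else t + 4^-1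
                else 2^-1 * t + 2^-1.
    rewrite /u; case: (leP (2 * t) (t + 4^-1)) => ?;
    case: (leP _ (2^-1 * t + 2^-1)) => ?;
    by case: (lerP t 2^-1) => ?; case: (lerP (2 * t) 2^-1) => ?; lra.
  rewrite uE /concat_fun /concat_fun.
  case: (lerP t 2^-1) => t2; last first.
    rewrite ifF; last by apply/negbTE; rewrite -ltNge; lra.
    rewrite /= /concat_fun ifF; last by apply/negbTE; rewrite -ltNge; lra.
    by congr (h _); lra.
  rewrite /= /concat_fun; case: (lerP (2 * t) 2^-1) => t4; first by rewrite t4.
  rewrite ifF; last by apply/negbTE; rewrite -ltNge; lra.
  rewrite ifT; last lra.
  by congr (g _); lra.
Qed.

Lemma tent_continuous : continuous (fun t : R => `|2 * t - 1|).
Proof.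
by continuity.
Qed.

Lemma tent01 (t : R) : I01 t -> 0 <= `|2 * t - 1| <= 1.
Proof. by move=> /in01 t01; rewrite normr_ge0 /= ler_norml; lra. Qed.

Lemma concat_revr (f : loop) :
  loop_homotopic (concat f (loop_rev f)) loop_cst.
Proof.
apply: (@homotopic_reparam f
  (fun z => (1 - z.1) * (1 - `|2 * z.2 - 1|))).
- by continuity.
- move=> s t /in01 s01 /tent01 t01 /=; apply/in01.
  by apply/andP; split; nra.
- move=> t /in01 t01 /=; rewrite subr0 mul1r /concat_fun /rev_fun.
  case: (lerP t 2^-1) => t2; congr (f _).
    by rewrite ler0_norm; lra.
  by rewrite ger0_norm; lra.
- by move=> t _; rewrite /= subrr mul0r loop0.
- move=> s _ /=; rewrite mulr0 sub0r normrN1 subrr mulr0 loop0; split=> //.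
  have -> : 2 * 1 - 1 = 1 :> R by ring.
  by rewrite normr1 subrr mulr0 loop0.
Qed.

Lemma concat_revl (f : loop) :
  loop_homotopic (concat (loop_rev f) f) loop_cst.
Proof.
apply: (@homotopic_reparam f
  (fun z => 1 - (1 - z.1) * (1 - `|2 * z.2 - 1|))).
- by continuity.
- move=> s t /in01 s01 /tent01 t01 /=; apply/in01.
  by apply/andP; split; nra.
- move=> t /in01 t01 /=; rewrite subr0 mul1r /concat_fun /rev_fun.
  case: (lerP t 2^-1) => t2; congr (f _).
    by rewrite ler0_norm; lra.
  by rewrite ger0_norm; lra.
- by move=> t _; rewrite /= subrr mul0r subr0 loop1.
- move=> s _ /=; rewrite mulr0 sub0r normrN1 subrr mulr0 subr0 loop1; split=> //.
  have -> : 2 * 1 - 1 = 1 :> R by ring.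
  by rewrite normr1 subrr mulr0 subr0 loop1.
Qed.

Definition pi1_mul (a b : pi1) : pi1 := \pi_pi1 (concat (repr a) (repr b)).
Definition pi1_one : pi1 := \pi_pi1 loop_cst.
Definition pi1_inv (a : pi1) : pi1 := \pi_pi1 (loop_rev (repr a)).

Lemma repr_pi1 (f : loop) : loop_homotopic (repr (\pi_pi1 f)) f.
Proof. by apply/pi1P; rewrite reprK. Qed.

Lemma pi1_mulE (f g : loop) :
  pi1_mul (\pi_pi1 f) (\pi_pi1 g) = \pi_pi1 (concat f g).
Proof. by apply/pi1P; apply: concat_homotopic; exact: repr_pi1. Qed.

Lemma pi1_invE (f : loop) : pi1_inv (\pi_pi1 f) = \pi_pi1 (loop_rev f).
Proof. by apply/pi1P; apply: rev_homotopic; exact: repr_pi1. Qed.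

Lemma pi1_mulA : associative pi1_mul.
Proof.
elim/quotW=> a; elim/quotW=> b; elim/quotW=> c.
rewrite (pi1_mulE b c) (pi1_mulE a b) !pi1_mulE.
by apply/pi1P/loop_homotopic_sym; exact: concatA_homotopic.
Qed.

Lemma pi1_mul1 : left_id pi1_one pi1_mul.
Proof.
by elim/quotW=> a; rewrite pi1_mulE; apply/pi1P; exact: concat_cstl.
Qed.

Lemma pi1_mulr1 : right_id pi1_one pi1_mul.
Proof.
by elim/quotW=> a; rewrite pi1_mulE; apply/pi1P; exact: concat_cstr.
Qed.

Lemma pi1_mulV : left_inverse pi1_one pi1_inv pi1_mul.
Proof.
by elim/quotW=> a; rewrite pi1_invE pi1_mulE; apply/pi1P; exact: concat_revl.
Qed.

Lemma pi1_mulrV : right_inverse pi1_one pi1_inv pi1_mul.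
Proof.
by elim/quotW=> a; rewrite pi1_invE pi1_mulE; apply/pi1P; exact: concat_revr.
Qed.

HB.instance Definition _ :=
  isGroup.Build pi1 pi1_mulA pi1_mul1 pi1_mulr1 pi1_mulV pi1_mulrV.

End Loops.

Section Induced.
Variables (S T : topologicalType) (f : S -> T) (x : S) (y : T).
Hypotheses (fc : continuous f) (fx : f x = y).

Lemma loop_map_cont (l : loop x) : {within I01, continuous (f \o l)}.
Proof.
apply: (@within_continuous_comp _ _ _ _ setT) => //; last exact: loop_cont.
exact: continuous_subspaceT.
Qed.

Lemma loop_map0 (l : loop x) : (f \o l) 0 = y.
Proof. by rewrite /= loop0. Qed.
Lemma loop_map1 (l : loop x) : (f \o l) 1 = y.
Proof. by rewrite /= loop1. Qed.

Definition loop_map (l : loop x) : loop y :=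
  Loop (@loop_map_cont l) (loop_map0 l) (loop_map1 l).

Lemma loop_map_homotopic (k l : loop x) :
  loop_homotopic k l -> loop_homotopic (loop_map k) (loop_map l).
Proof.
move=> [H [cH H0 H1 Hx]]; exists (f \o H); split => /=.
- apply: (@within_continuous_comp _ _ _ _ setT) => //.
  exact: continuous_subspaceT.
- by move=> t t01; rewrite H0.
- by move=> t t01; rewrite H1.
- by move=> s s01; rewrite (Hx _ s01).1 (Hx _ s01).2 fx.
Qed.

Definition pi1_map (a : pi1 x) : pi1 y := \pi_(pi1 y) (loop_map (repr a)).

Lemma pi1_mapE (l : loop x) : pi1_map (\pi_(pi1 x) l) = \pi_(pi1 y) (loop_map l).
Proof. by apply/pi1P/loop_map_homotopic; exact: repr_pi1. Qed.

End Induced.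
End FundamentalGroup.

Section Smooth.
Variable R : realType.
Implicit Types m n k : nat.

(* f is C^k on the open set U *)
Fixpoint Ck k n (U : set 'rV[R]_n) (f : 'rV[R]_n -> R) : Prop :=
  {in U, continuous f} /\
  if k is k'.+1 then
    forall i : 'I_n, (forall x, U x -> derivable (f : _ -> R^o) x (delta_mx 0 i)) /\
      Ck k' U (fun x => 'D_(delta_mx 0 i) (f : _ -> R^o) x)
  else True.

Definition smooth_open m n (U : set 'rV[R]_m) (f : 'rV[R]_m -> 'rV[R]_n) : Prop :=
  forall k (j : 'I_n), Ck k U (fun x => f x 0 j).

Definition smooth_extension m n (S : set 'rV[R]_m) (f : 'rV[R]_m -> 'rV[R]_n)
    (x : 'rV[R]_m) (U : set 'rV[R]_m) (F : 'rV[R]_m -> 'rV[R]_n) : Prop :=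
  [/\ open U, U x, smooth_open U F & forall y, U y -> S y -> F y = f y].

Definition smooth_on m n (S : set 'rV[R]_m) (f : 'rV[R]_m -> 'rV[R]_n) : Prop :=
  forall x, S x -> exists U F, smooth_extension S f x U F.

(* The Jacobian determinant of f : S -> R^n at x has sign (-1)^s.  When S is
   relatively open in an orthant the derivative at x of a smooth extension
   of f does not depend on the extension. *)
Definition jacobian_sign n (S : set 'rV[R]_n) (f : 'rV[R]_n -> 'rV[R]_n)
    (x : 'rV[R]_n) (s : bool) : Prop :=
  exists U F, smooth_extension S f x U F /\ 0 < (-1) ^+ s * \det ('J F x).

Definition orthant n : set 'rV[R]_n := [set xi | forall i, 0 <= xi 0 i].

Definition disc n (xi0 : 'rV[R]_n) (eps : R) : set 'rV[R]_n :=
  [set xi | \sum_i (xi 0 i - xi0 0 i) ^+ 2 < eps ^+ 2].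

End Smooth.

(* g is a continuous inverse of the continuous map f : A -> B *)
Definition homeo_on (S T : topologicalType) (A : set S) (B : set T)
    (f : S -> T) (g : T -> S) : Prop :=
  [/\ {homo f : x / A x >-> B x} /\ {homo g : y / B y >-> A y},
      {within A, continuous f} /\ {within B, continuous g},
      {in A, cancel f g} & {in B, cancel g f}].

Record chart (R : realType) (n : nat) (M : topologicalType) := Chart {
  dom : set M;
  coord : M -> 'rV[R]_n;
  param : 'rV[R]_n -> M }.

(* Smooth structures modelled on relatively open subsets of H, where H is the
   orthant (manifolds with corners) or the whole space (manifolds). *)
Record smooth_structure (R : realType) (n : nat) (H : set 'rV[R]_n)
    (M : topologicalType) := SmoothStructure {
  atlas : set (chart R n M);
  atlas_open : forall c, atlas c -> open (dom c) /\
    exists2 V, open V & homeo_on (dom c) (V `&` H) (coord c) (param c);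
  atlas_cover : forall x, exists2 c, atlas c & dom c x;
  atlas_smooth : forall c d, atlas c -> atlas d ->
    smooth_on (coord c @` (dom c `&` dom d)) (coord d \o param c) }.

(* An orientation gives each chart a locally constant sign on its domain
   (false: positively oriented there); the signs are needed because, in
   dimension 1, an orientation-preserving chart into the orthant need not exist
   around a boundary point. *)
Record orientation (R : realType) (n : nat) (H : set 'rV[R]_n)
    (M : topologicalType) (S : smooth_structure H M) := Orientation {
  osign : chart R n M -> M -> bool;
  osign_locally_constant : forall c, atlas S c ->
    forall x, dom c x -> \forall y \near x, osign c y = osign c x;
  osign_transition : forall c d, atlas S c -> atlas S d ->
    forall x, dom c x -> dom d x ->
    jacobian_sign (coord c @` (dom c `&` dom d)) (coord d \o param c)
      (coord c x) (osign c x (+) osign d x) }.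

(* Compact, connected and oriented smooth manifolds. *)
Record manifold (R : realType) (n : nat) (H : set 'rV[R]_n) := Manifold {
  carrier :> topologicalType;
  manifold_hausdorff : hausdorff_space carrier;
  manifold_second_countable : @second_countable carrier;
  manifold_compact : compact [set: carrier];
  manifold_connected : connected [set: carrier];
  smooth_str : smooth_structure H carrier;
  orient : orientation smooth_str }.

Section Manifolds.
Variables (R : realType) (n : nat) (H : set 'rV[R]_n) (M : manifold H).

Definition diffeo (U : set M) (V : set 'rV[R]_n) (f : M -> 'rV[R]_n) : Prop :=
  exists g : 'rV[R]_n -> M,
  [/\ homeo_on U V f g,
      forall c, atlas (smooth_str M) c ->
        smooth_on (coord c @` (dom c `&` U)) (f \o param c) &
      forall c, atlas (smooth_str M) c ->
        smooth_on (V `&` g @^-1` dom c) (coord c \o g)].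

Definition orientation_preserving (U : set M) (f : M -> 'rV[R]_n) : Prop :=
  forall c, atlas (smooth_str M) c -> forall x, dom c x -> U x ->
  jacobian_sign (coord c @` (dom c `&` U)) (f \o param c) (coord c x)
    (osign (orient M) c x).

End Manifolds.

Definition manifold_with_corners (R : realType) (n : nat) :=
  manifold (@orthant R n).

Definition closed_manifold (R : realType) (n : nat) :=
  manifold [set: 'rV[R]_n].

(* S^(k)B: the points with n - k vanishing coordinates *)
Definition stratum (R : realType) (n : nat) (B : manifold_with_corners R n)
    (k : nat) : set B :=
  [set b | exists c, [/\ atlas (smooth_str B) c, dom c b &
    (#|[set i | coord c b ord0 i == 0%R]%SET| + k)%N = n]].

Arguments stratum {R n} B k.

Section SpecialLinear.
Variable n : nat.

Definition SLZ := {A : 'M[int]_n | \det A == 1}.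

HB.instance Definition _ := Choice.on SLZ.
HB.instance Definition _ :=
  DiscreteTopology.copy SLZ (discrete_topology SLZ).

Lemma SLZ_one_subproof : \det (1%:M : 'M[int]_n) == 1.
Proof. by rewrite det1. Qed.

Lemma SLZ_mul_subproof (A B : SLZ) : \det (val A *m val B) == 1.
Proof. by rewrite det_mulmx (eqP (valP A)) (eqP (valP B)) mulr1. Qed.

Lemma SLZ_inv_subproof (A : SLZ) : \det (\adj (val A)) == 1.
Proof.
apply/eqP; have := congr1 determinant (mul_mx_adj (val A)).
by rewrite det_mulmx (eqP (valP A)) det1 mul1r.
Qed.

Definition SLZ_one : SLZ := Sub 1%:M SLZ_one_subproof.
Definition SLZ_mul (A B : SLZ) : SLZ := Sub (val A *m val B) (SLZ_mul_subproof A B).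
Definition SLZ_inv (A : SLZ) : SLZ := Sub (\adj (val A)) (SLZ_inv_subproof A).

Lemma SLZ_mulA : associative SLZ_mul.
Proof. by move=> A B C; apply: val_inj; rewrite /= mulmxA. Qed.
Lemma SLZ_mul1 : left_id SLZ_one SLZ_mul.
Proof. by move=> A; apply: val_inj; rewrite /= mul1mx. Qed.
Lemma SLZ_mulr1 : right_id SLZ_one SLZ_mul.
Proof. by move=> A; apply: val_inj; rewrite /= mulmx1. Qed.
Lemma SLZ_mulV : left_inverse SLZ_one SLZ_inv SLZ_mul.
Proof. by move=> A; apply: val_inj; rewrite /= mul_adj_mx (eqP (valP A)). Qed.
Lemma SLZ_mulrV : right_inverse SLZ_one SLZ_inv SLZ_mul.
Proof. by move=> A; apply: val_inj; rewrite /= mul_mx_adj (eqP (valP A)). Qed.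

HB.instance Definition _ :=
  isGroup.Build SLZ SLZ_mulA SLZ_mul1 SLZ_mulr1 SLZ_mulV SLZ_mulrV.

Lemma SLZ_val1 : val (1%g : SLZ) = 1%:M.
Proof. by []. Qed.
Lemma SLZ_valM (A B : SLZ) : val (A * B)%g = val A *m val B.
Proof. by []. Qed.

End SpecialLinear.

Section Torus.
Variables (R : realType) (n : nat).

Let lattice_rel (x y : 'rV[R]_n) : bool :=
  `[< exists z : 'rV[int]_n, y - x = map_mx intr z >].

Lemma lattice_rel_refl : reflexive lattice_rel.
Proof.
by move=> x; apply/asboolP; exists 0; rewrite subrr map_mx0.
Qed.

Lemma lattice_rel_sym : symmetric lattice_rel.
Proof.
suff H x y : lattice_rel x y -> lattice_rel y x.
  by move=> x y; apply/idP/idP; exact: H.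
move=> /asboolP[z xyz]; apply/asboolP; exists (- z).
by rewrite map_mxN -xyz opprB.
Qed.

Lemma lattice_rel_trans : transitive lattice_rel.
Proof.
move=> y x z /asboolP[u xyu] /asboolP[v yzv]; apply/asboolP; exists (u + v).
by rewrite map_mxD -xyu -yzv [RHS]addrC addrA subrK.
Qed.

Definition lattice_equiv :=
  EquivRel lattice_rel lattice_rel_refl lattice_rel_sym lattice_rel_trans.

(* T^n = R^n / Z^n *)
Definition torus := {eq_quot lattice_equiv}.

HB.instance Definition _ := Topological.copy torus (quotient_topology torus).
HB.instance Definition _ := Quotient.on torus.

(* T^n consists of row vectors, on which the matrix A acts by x |-> x *m A^T *)
Definition SLZ_torus (A : SLZ n) (theta : torus) : torus :=
  \pi_torus (repr theta *m (map_mx intr (val A))^T).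

Lemma torusP (x y : 'rV[R]_n) :
  \pi_torus x = \pi_torus y <-> exists z : 'rV[int]_n, y - x = map_mx intr z.
Proof. by split=> [/eqmodP/asboolP|?]; last by apply/eqmodP/asboolP. Qed.

Lemma SLZ_torusE (A : SLZ n) (x : 'rV[R]_n) :
  SLZ_torus A (\pi_torus x) = \pi_torus (x *m (map_mx intr (val A))^T).
Proof.
have /torusP[z xz] : \pi_torus (repr (\pi_torus x)) = \pi_torus x by rewrite reprK.
apply/torusP; exists (z *m (val A)^T).
by rewrite -mulmxBl xz map_mxM map_trmx.
Qed.

Lemma SLZ_torus1 (theta : torus) : SLZ_torus 1%g theta = theta.
Proof.
elim/quotW: theta => x.
by rewrite SLZ_torusE SLZ_val1 map_mx1 trmx1 mulmx1.
Qed.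

Lemma SLZ_torusM (A B : SLZ n) (theta : torus) :
  SLZ_torus (A * B)%g theta = SLZ_torus A (SLZ_torus B theta).
Proof.
elim/quotW: theta => x.
by rewrite (SLZ_torusE B) (SLZ_torusE A) SLZ_torusE SLZ_valM map_mxM trmx_mul mulmxA.
Qed.

(* C^n is identified with R^(2n) by the coordinates (x_1, y_1, ..., x_n, y_n):
   mxvec_index i 0 and mxvec_index i 1 are the positions 2i and 2i+1 of x_i
   and y_i (counting from 0).  In these coordinates, the standard complex
   orientation of C^n is the standard orientation of R^(2n). *)
Definition re_part (z : 'rV[R]_(n * 2)) (i : 'I_n) : R :=
  z 0 (mxvec_index i (0 : 'I_2)).
Definition im_part (z : 'rV[R]_(n * 2)) (i : 'I_n) : R :=
  z 0 (mxvec_index i (1 : 'I_2)).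

Definition mu_C (z : 'rV[R]_(n * 2)) : 'rV[R]_n :=
  \row_i (re_part z i ^+ 2 + im_part z i ^+ 2).

Definition nu_C (xi : 'rV[R]_n) (theta : torus) : 'rV[R]_(n * 2) :=
  mxvec (\matrix_(i < n, j < 2)
    (Num.sqrt (xi 0 i) * (if j == 0 then cos (2 * pi * repr theta 0 i)
                          else sin (2 * pi * repr theta 0 i)))).

Lemma periodic_intr (f : R -> R) (t : R) (z : int) :
  periodic f (pi *+ 2) -> f (2 * pi * (t + z%:~R)) = f (2 * pi * t).
Proof.
move=> fp; have fn (k : nat) u : f (2 * pi * (u + k%:R)) = f (2 * pi * u).
  rewrite -[RHS](periodicn fp k); congr f.
  by rewrite mulrDr mulr_natr [2 * pi]mulr_natl.
case: z => k; first exact: fn.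
by rewrite NegzE mulrNz -pmulrn -[LHS](fn k.+1) subrK.
Qed.

Lemma nu_CE (xi x : 'rV[R]_n) : nu_C xi (\pi_torus x) =
  mxvec (\matrix_(i < n, j < 2)
    (Num.sqrt (xi 0 i) * (if j == 0 then cos (2 * pi * x 0 i)
                          else sin (2 * pi * x 0 i)))).
Proof.
have /torusP[z xz] : \pi_torus x = \pi_torus (repr (\pi_torus x)) by rewrite reprK.
have E i : repr (\pi_torus x) 0 i = x 0 i + (z 0 i)%:~R.
  by have /matrixP/(_ 0 i) := xz; rewrite !mxE => <-; rewrite [RHS]addrC subrK.
congr mxvec; apply/matrixP => i j; rewrite !mxE E.
by rewrite (periodic_intr _ _ (@cosD2pi R)) (periodic_intr _ _ (@sinD2pi R)).
Qed.

End Torus.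

(* A local trivialization proj^-1(U) -> U x SL_n(Z), with SL_n(Z) discrete *)
Definition local_trivialization (n : nat) (B P : topologicalType)
    (ract : P -> SLZ n -> P) (proj : P -> B) (U : set B)
    (phi : P -> B * SLZ n) : Prop :=
  [/\ exists psi, homeo_on (proj @^-1` U) (U `*` [set: SLZ n]) phi psi,
      forall p, U (proj p) -> (phi p).1 = proj p &
      forall p A, U (proj p) -> (phi (ract p A)).2 = ((phi p).2 * A)%g].

(* Principal SL_n(Z)-bundles, for a right action.  The structure group is
   discrete, so the smooth structure is determined by the topology. *)
Record principal_bundle (n : nat) (B : topologicalType) := PrincipalBundle {
  total :> topologicalType;
  ract : total -> SLZ n -> total;
  proj : total -> B;
  ract_continuous : forall A, continuous (ract^~ A);
  ract1 : forall p, ract p 1%g = p;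
  ractM : forall p A A', ract p (A * A')%g = ract (ract p A) A';
  proj_continuous : continuous proj;
  proj_ract : forall p A, proj (ract p A) = proj p;
  locally_trivial : forall b, exists (U : set B) (phi : total -> B * SLZ n),
    [/\ open U, U b & local_trivialization ract proj U phi] }.

Section AssociatedBundle.
Variables (R : realType) (n : nat) (B : topologicalType).
Variable P : principal_bundle n B.

Let assoc_rel (u v : P * torus R n) : bool :=
  `[< exists A, v.1 = ract u.1 A /\ u.2 = SLZ_torus A v.2 >].

Lemma assoc_rel_refl : reflexive assoc_rel.
Proof. by move=> u; apply/asboolP; exists 1%g; rewrite ract1 SLZ_torus1. Qed.

Lemma assoc_rel_sym : symmetric assoc_rel.
Proof.
suff H u v : assoc_rel u v -> assoc_rel v u.
  by move=> u v; apply/idP/idP; exact: H.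
move=> /asboolP[A [vE uE]]; apply/asboolP; exists (A^-1)%g.
by rewrite vE uE -ractM -SLZ_torusM mulgV mulVg ract1 SLZ_torus1.
Qed.

Lemma assoc_rel_trans : transitive assoc_rel.
Proof.
move=> v u w /asboolP[A [vE uE]] /asboolP[A' [wE vE']]; apply/asboolP.
by exists (A * A')%g; rewrite ractM SLZ_torusM -vE wE -vE' uE.
Qed.

Definition assoc_equiv :=
  EquivRel assoc_rel assoc_rel_refl assoc_rel_sym assoc_rel_trans.

(* T^n_P = P x_{SL_n(Z)} T^n, where (p A, theta) ~ (p, A theta) *)
Definition assoc_torus := {eq_quot assoc_equiv}.

HB.instance Definition _ :=
  Topological.copy assoc_torus (quotient_topology assoc_torus).
HB.instance Definition _ := Quotient.on assoc_torus.

Lemma assoc_torusP (u v : P * torus R n) :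
  \pi_assoc_torus u = \pi_assoc_torus v <->
  exists A, v.1 = ract u.1 A /\ u.2 = SLZ_torus A v.2.
Proof. by split=> [/eqmodP/asboolP|?]; last by apply/eqmodP/asboolP. Qed.

Definition assoc_proj (y : assoc_torus) : B := proj (repr y).1.

Lemma assoc_projE (u : P * torus R n) :
  assoc_proj (\pi_assoc_torus u) = proj u.1.
Proof.
have /assoc_torusP[A [-> _]] :
  \pi_assoc_torus (repr (\pi_assoc_torus u)) = \pi_assoc_torus u by rewrite reprK.
by rewrite proj_ract.
Qed.

(* the map phi^T induced by phi^P; it is meaningful over the domain of phi^P *)
Definition assoc_trivialization (phi : P -> B * SLZ n) (y : assoc_torus) :
    B * torus R n :=
  ((phi (repr y).1).1, SLZ_torus (phi (repr y).1).2 (repr y).2).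

Lemma assoc_trivializationE (U : set B) (phi : P -> B * SLZ n)
    (u : P * torus R n) :
  local_trivialization (@ract _ _ P) (@proj _ _ P) U phi -> U (proj u.1) ->
  assoc_trivialization phi (\pi_assoc_torus u) =
    (proj u.1, SLZ_torus (phi u.1).2 u.2).
Proof.
move=> [_ phi1 phiM]; rewrite /assoc_trivialization.
have /assoc_torusP[A [-> ->]] :
  \pi_assoc_torus (repr (\pi_assoc_torus u)) = \pi_assoc_torus u by rewrite reprK.
rewrite proj_ract => Uu.
by rewrite phi1 // phiM // SLZ_torusM.
Qed.

End AssociatedBundle.

Section TwistedToric.
Variables (R : realType) (n : nat) (B : manifold_with_corners R n).
Variables (P : principal_bundle n B) (X : closed_manifold R (n * 2)).

Record locally_toric_chart (nu : assoc_torus R P -> X) (mu : X -> B) (b : B)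
    (U : set B) (xi0 : 'rV[R]_n) (eps : R) (phiP : P -> B * SLZ n)
    (phiX : X -> 'rV[R]_(n * 2)) (phiB : B -> 'rV[R]_n) : Prop := {
  ltc_open : open U;
  ltc_mem : U b;
  ltc_center : orthant xi0;
  ltc_radius : 0 < eps;
  ltc_phiB : diffeo U (@orthant R n `&` disc xi0 eps) phiB;
  ltc_phiB_orientation : orientation_preserving U phiB;
  ltc_phiB_center : phiB b = xi0;
  ltc_phiP : local_trivialization (@ract _ _ P) (@proj _ _ P) U phiP;
  ltc_phiX : diffeo (mu @^-1` U) (@mu_C R n @^-1` disc xi0 eps) phiX;
  ltc_phiX_orientation : orientation_preserving (mu @^-1` U) phiX;
  ltc_nu : forall y, U (assoc_proj y) ->
    phiX (nu y) = nu_C (phiB (assoc_trivialization phiP y).1)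
                       (assoc_trivialization phiP y).2;
  ltc_mu : forall x, U (mu x) -> mu_C (phiX x) = phiB (mu x) }.

Record twisted_toric := TwistedToric {
  nu : assoc_torus R P -> X;
  mu : X -> B;
  nu_continuous : continuous nu;
  mu_continuous : continuous mu;
  nu_surjective : range nu = [set: X];
  mu_surjective : range mu = [set: B];
  mu_nu : forall y, mu (nu y) = assoc_proj y;
  locally_toric : forall b, exists U xi0 eps phiP phiX phiB,
    locally_toric_chart nu mu b U xi0 eps phiP phiX phiB }.

Lemma mu_nu_base (T : twisted_toric) (b : B) (y0 : assoc_torus R P) :
  assoc_proj y0 = b -> mu T (nu T y0) = b.
Proof. by move=> <-; exact: mu_nu. Qed.

End TwistedToric.

Definition group_isomorphism (G H : groupType) (f : G -> H) : Prop :=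
  bijective f /\ {morph f : a b / (a * b)%g}.

(* Main.v *)
Require Import Defs.
From HB Require Import structures.
From mathcomp Require Import all_boot all_order all_algebra.
From mathcomp Require Import generic_quotient.
From mathcomp Require Import all_classical all_reals all_analysis.
From mathcomp Require Import ring lra.

(** The map [mu] has the section [zsec] which sends [b] to the point of angle 0 in
the torus over [b]; it is globally defined because the structure group acts on
the torus by linear automorphisms.  A section alone says nothing about
injectivity of the induced map, and this is what the corner is for.

Each point [z] of [X] lies in a torus orbit, hence is joined to
[zsec (mu z)] by a radial path, along which its angles are scaled down to 0.  The
angles of [z] are only defined up to integers, so two radial paths from [z] differ by
the image of a closed one-parameter subgroup of the torus.  Such a loop can be moved
freely along any path of the base, without changing whether it contracts, and
over a corner the whole torus is collapsed to a point.  As the base is connected,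
all these loops contract in [X] ([contractible_corner], [contractible_local],
[contractible_all]), and the homotopy class [radial z] of the radial path depends on
[z] only ([radial_unique]).

These classes form a natural transformation between the identity and
[zsec \o mu] on the fundamental groupoid of [X] ([radial_natural]).  Naturality
can be checked on short pieces of a curve, since it is inherited by concatenation and
an interval is connected.  A short piece lies in a ball of a toric chart,
so it is homotopic to any other curve of that ball with the same endpoints,
in particular to one that is linear in polar coordinates (radii and angles); for
such a curve the angles can be scaled down to 0 continuously, which produces the
commuting square.  At a point where some coordinate vanishes its angle is arbitrary,
but a curve with small radius stays in a small disc whatever its angle does
([polar_local], [cpolar_local]).

Naturality makes the map of fundamental groups injective: a loop is conjugate, by
the radial class, to the image under [zsec] of its projection.  It is surjective
because conjugating [zsec \o g] by the radial class lifts the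
class of a loop [g].

The definition of a corner refers to the smooth atlas, while the collapse takes place
where all coordinates of a toric chart vanish.  The two agree because a
diffeomorphism between open subsets of the orthant respects the corner
([diffeo_corner]). *)

Set Implicit Arguments.
Unset Strict Implicit.
Unset Printing Implicit Defensive.

Import Order.TTheory GRing.Theory Num.Theory.
Import numFieldNormedType.Exports.
Local Open Scope classical_set_scope.
Local Open Scope ring_scope.
Local Open Scope quotient_scope.

Local Notation I01 R := (`[0%R : R, 1%R]%classic).
Local Notation I2 R := (I01 R `*` I01 R).

(** * Continuity, convexity and connectedness *)

Lemma within_continuous_pair (S T U : topologicalType) (A : set S)
    (f : S -> T) (g : S -> U) :
  {within A, continuous f} -> {within A, continuous g} ->
  {within A, continuous (fun z => (f z, g z))}.
Proof. by move=> cf cg z; apply: cvg_pair; [exact: cf|exact: cg]. Qed.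

(** Neighbourhoods of matrices are defined entrywise. *)
Lemma rV_continuous (S : topologicalType) (R : realType) m (f : S -> 'rV[R]_m) :
  (forall j, continuous (fun s => f s ord0 j)) -> continuous f.
Proof.
move=> cf s A [Q nQ QA]; have : \forall w \near s, forall j, Q ord0 j (f w ord0 j).
  by apply: filter_forall => j; apply: cf; exact: nQ.
by apply: filterS => w Qw; apply: QA => i j; rewrite ord1.
Qed.

Lemma affine_rV_continuous (R : realType) m (S : topologicalType) (f : S -> R)
    (x v : 'rV[R]_m) :
  continuous f -> continuous (fun z => x + f z *: v).
Proof.
move=> cf; apply: rV_continuous => j.
rewrite (_ : (fun _ => _) = fun z => x ord0 j + f z * v ord0 j).
  apply: continuous_addr; first exact: cst_continuous.
  by apply: continuous_mulr => //; exact: cst_continuous.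
by apply: boolp.funext => z; rewrite !mxE.
Qed.

Lemma disc_open (R : realType) n xi0 (eps : R) : open (@disc R n xi0 eps).
Proof.
rewrite (_ : disc _ _ = (fun xi : 'rV[R]_n => \sum_i (xi 0 i - xi0 0 i) ^+ 2) @^-1`
  [set y | y < eps ^+ 2]) //.
apply: open_comp; last exact: open_lt.
move=> xi _; apply: (@continuous_big _ _ (@GRing.add R) 0 xpredT).
  by apply: continuous_addr; [exact: continuous_fst|exact: continuous_snd].
move=> i _ {}xi; rewrite /=.
have c1 : continuous (fun xi : 'rV[R]_n => xi 0 i - xi0 0 i).
  by apply: continuous_subr; [exact: coord_continuous|exact: continuous_cst].
by apply: continuous_mulr.
Qed.

Lemma ball_convex (R : realType) (E : normedModType R) (x : E) r a b (t : R) :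
  ball x r a -> ball x r b -> I01 R t -> ball x r (a + t *: (b - a)).
Proof.
rewrite -!ball_normE /ball_ /= => xa xb /in01 /andP[t0 t1].
have -> : x - (a + t *: (b - a)) = (1 - t) *: (x - a) + t *: (x - b).
  rewrite scalerBl scale1r -addrA [- _ + _]addrC -scalerBr.
  have -> : x - b - (x - a) = - (b - a).
    by rewrite !opprB addrC addrA subrK.
  by rewrite scalerN opprD addrA.
rewrite (le_lt_trans (ler_normD _ _)) // !normrZ !ger0_norm // ?subr_ge0 //.
have [->|t1'] := eqVneq t 1; first by rewrite subrr mul0r add0r mul1r.
have {t1'}t1 : 0 < 1 - t by rewrite subr_gt0 lt_neqAle t1' t1.
by nra.
Qed.

(** The points to which [x] is related form a clopen subset of [A].  The lemma serves
twice: to carry a property of fibres from one point of the base to all others,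
and to pass from short arcs of a curve to the whole curve. *)
Lemma connected_chain (T : topologicalType) (A : set T) (C : T -> T -> Prop) :
  connected A -> (forall x y z, A x -> A y -> A z -> C x y -> C y z -> C x z) ->
  (forall x, A x -> \forall y \near x, A y -> C x y /\ C y x) ->
  forall x y, A x -> A y -> C x y.
Proof.
move=> cA Ctr Cloc x y Ax Ay.
have Cxx : C x x by have /nbhs_singleton/(_ Ax)[] := Cloc _ Ax.
suff E : A `&` [set z | C x z] = A by have : A y := Ay; rewrite -E => -[].
apply: cA.
- by exists x.
- exists (interior [set z | A z -> C x z]); first exact: open_interior.
  apply/seteqP; split => z [Az]; last by move=> /interior_subset/(_ Az).
  move=> Cxz; split => //; have := Cloc _ Az; rewrite /interior /=.
  by apply: filterS => w Cw Aw; apply: (Ctr _ z) => //; exact: (Cw Aw).1.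
- exists (~` interior [set z | A z -> ~ C x z]).
    exact/open_closedC/open_interior.
  apply/seteqP; split => z [Az].
    by move=> Cxz; split => // /interior_subset/(_ Az).
  move=> Cxz; split => //=; apply: contrapT => nCxz; apply: Cxz.
  have := Cloc _ Az; rewrite /interior /=; apply: filterS => w Cw Aw Cxw.
  by apply: nCxz; apply: (Ctr _ w) => //; exact: (Cw Aw).2.
Qed.

(** * The fundamental groupoid *)

Section Pasting.
Variables (R : realType) (T : topologicalType).

(** Pasting in the second coordinate yields both composition of homotopies between
composable curves and, after exchanging the coordinates, transitivity of homotopy. *)
Definition vpaste (H K : R * R -> T) (z : R * R) : T :=
  if z.2 <= 2^-1 then H (z.1, 2 * z.2) else K (z.1, 2 * z.2 - 1).

Lemma vpaste_cont (H K : R * R -> T) :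
  {within I2 R, continuous H} -> {within I2 R, continuous K} ->
  (forall s, I01 R s -> H (s, 1) = K (s, 0)) ->
  {within I2 R, continuous (vpaste H K)}.
Proof.
move=> cH cK HK.
apply: (within_continuous_glue (@closed_lhalf2 R) (@closed_rhalf2 R) _ _ _
  (@closed01 R)).
- by move=> [s t] _ /=; case: (lerP t 2^-1) => [?|/ltW ?]; [left|right].
- apply: (@within_continuous_eq _ _ _ (H \o (fun z => (z.1, 2 * z.2)))).
    by move=> z [/= z2 _]; rewrite /vpaste z2.
  apply: (@Defs.within_continuous_comp _ _ _ _ (I2 R)) => //.
    by apply: continuous_subspaceT; continuity.
  by move=> [s t] /= [? [? /in01 ?]]; split => //=; apply/in01; lra.
- apply: (@within_continuous_eq _ _ _ (K \o (fun z => (z.1, 2 * z.2 - 1)))).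
    move=> [s t] [/= s2 [/= s01 _]]; rewrite /vpaste /=.
    case: (lerP t 2^-1) => // t2'; have -> : t = 2^-1 by lra.
    by rewrite mulfV// subrr HK.
  apply: (@Defs.within_continuous_comp _ _ _ _ (I2 R)) => //.
    by apply: continuous_subspaceT; continuity.
  by move=> [s t] /= [? [? /in01 ?]]; split => //=; apply/in01; lra.
Qed.

Lemma swap_cont (H : R * R -> T) : {within I2 R, continuous H} ->
  {within I2 R, continuous (fun z => H (z.2, z.1))}.
Proof.
move=> cH; apply: (@Defs.within_continuous_comp _ _ _ _ (I2 R) H
    (fun z => (z.2, z.1))) => //.
  by apply: continuous_subspaceT; continuity.
by move=> [s t] [].
Qed.

End Pasting.

Section Curves.
Variables (R : realType) (T : topologicalType).

(** As the endpoints are recorded by equations, a function may be regarded as a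
curve between points that are only provably equal to its values at 0 and 1. *)
Record curve (x y : T) := Curve {
  curve_fun :> R -> T;
  curve_cont : {within I01 R, continuous curve_fun};
  curve0 : curve_fun 0 = x;
  curve1 : curve_fun 1 = y }.

HB.instance Definition _ x y := gen_eqMixin (curve x y).
HB.instance Definition _ x y := gen_choiceMixin (curve x y).

Definition curve_homotopic x y (f g : curve x y) : Prop :=
  exists H : R * R -> T,
  [/\ {within I2 R, continuous H},
      forall t, I01 R t -> H (0, t) = f t,
      forall t, I01 R t -> H (1, t) = g t &
      forall s, I01 R s -> H (s, 0) = x /\ H (s, 1) = y].

Lemma curve_homotopic_eq x y (f g : curve x y) :
  (forall t, I01 R t -> f t = g t) -> curve_homotopic f g.
Proof.
move=> fg; exists (f \o snd); split => //=.
- apply: (@Defs.within_continuous_comp _ _ _ _ (I01 R)); first exact: curve_cont.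
    by apply: continuous_subspaceT; continuity.
  by move=> [s t] [].
- by move=> s _; rewrite curve0 curve1.
Qed.

Lemma curve_homotopic_sym x y (f g : curve x y) :
  curve_homotopic f g -> curve_homotopic g f.
Proof.
move=> [H [cH H0 H1 Hx]].
exists (H \o (fun z => (1 - z.1, z.2))); split.
- apply: (@Defs.within_continuous_comp _ _ _ _ (I2 R)) => //.
    by apply: continuous_subspaceT; continuity.
  by move=> [s t] [] /in01 /= ? ?; split => //=; apply/in01; lra.
- by move=> t t01; rewrite /= subr0 H1.
- by move=> t t01; rewrite /= subrr H0.
- by move=> s /in01 s01 /=; apply: Hx; apply/in01; lra.
Qed.

Lemma vpaste0 (H K : R * R -> T) s : vpaste H K (s, 0) = H (s, 0).
Proof. by rewrite /vpaste ifT ?mulr0 //= invr_ge0. Qed.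

Lemma vpaste1 (H K : R * R -> T) s : vpaste H K (s, 1) = K (s, 1).
Proof.
rewrite /vpaste ifF /=; last by apply/negbTE; rewrite -ltNge; lra.
by congr (K (_, _)); lra.
Qed.

Lemma vpaste_ind (P : R -> T -> Prop) (H K : R * R -> T) s :
  (forall t, I01 R t -> P s (H (s, t)) /\ P s (K (s, t))) ->
  forall t, I01 R t -> P s (vpaste H K (s, t)).
Proof.
move=> PHK t /in01 t01; rewrite /vpaste /=; case: (lerP t 2^-1) => t2.
  by apply: (PHK _ _).1; apply/in01; lra.
by apply: (PHK _ _).2; apply/in01; lra.
Qed.

Lemma curve_homotopic_trans x y (f g h : curve x y) :
  curve_homotopic f g -> curve_homotopic g h -> curve_homotopic f h.
Proof.
move=> [H [cH H0 H1 Hx]] [K [cK K0 K1 Kx]].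
pose L := vpaste (fun z => H (z.2, z.1)) (fun z => K (z.2, z.1)).
exists (fun z => L (z.2, z.1)); split.
- apply/swap_cont/vpaste_cont; [exact: swap_cont|exact: swap_cont|].
  by move=> t t01 /=; rewrite K0 // H1.
- by move=> t t01 /=; rewrite /L vpaste0 H0.
- by move=> t t01 /=; rewrite /L vpaste1 K1.
- move=> s s01 /=; split.
    apply: (@vpaste_ind (fun _ w => w = x) _ _ 0 _ s s01) => t t01 /=.
    by rewrite (Hx _ t01).1 (Kx _ t01).1.
  apply: (@vpaste_ind (fun _ w => w = y) _ _ 1 _ s s01) => t t01 /=.
  by rewrite (Hx _ t01).2 (Kx _ t01).2.
Qed.

Section HomSet.
Variables x y : T.

Let crel (f g : curve x y) : bool := `[< curve_homotopic f g >].

Lemma crel_refl : reflexive crel.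
Proof. by move=> f; apply/asboolP; exact: curve_homotopic_eq. Qed.

Lemma crel_sym : symmetric crel.
Proof.
by move=> f g; apply/idP/idP => /asboolP fg; apply/asboolP;
  exact: curve_homotopic_sym.
Qed.

Lemma crel_trans : transitive crel.
Proof.
move=> g f h /asboolP fg /asboolP gh; apply/asboolP.
exact: curve_homotopic_trans gh.
Qed.

Definition curve_equiv := EquivRel crel crel_refl crel_sym crel_trans.

Definition hom := {eq_quot curve_equiv}.

HB.instance Definition _ := EqQuotient.on hom.
HB.instance Definition _ := Choice.on hom.

Definition cls (f : curve x y) : hom := \pi_hom f.

Lemma clsP (f g : curve x y) : cls f = cls g <-> curve_homotopic f g.
Proof. by split => [/eqmodP/asboolP//|?]; apply/eqmodP/asboolP. Qed.

Lemma cls_eq (f g : curve x y) : (forall t, I01 R t -> f t = g t) -> cls f = cls g.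
Proof. by move=> fg; apply/clsP; exact: curve_homotopic_eq. Qed.

End HomSet.

Lemma ccomp_cont x y z (f : curve x y) (g : curve y z) :
  {within I01 R, continuous (concat_fun f g)}.
Proof.
pose F := vpaste (f \o snd) (g \o snd).
apply: (@within_continuous_eq _ _ _ (F \o (fun t => (0, t)))) => //.
apply: (@Defs.within_continuous_comp _ _ _ _ (I2 R)).
- apply: vpaste_cont; last by move=> s _ /=; rewrite curve0 curve1.
    apply: (@Defs.within_continuous_comp _ _ _ _ (I01 R)); first exact: curve_cont.
      by apply: continuous_subspaceT; continuity.
    by move=> [s t] [].
  apply: (@Defs.within_continuous_comp _ _ _ _ (I01 R)); first exact: curve_cont.
    by apply: continuous_subspaceT; continuity.
  by move=> [s t] [].
- by apply: continuous_subspaceT; continuity.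
- by move=> t t01; split => //; apply/in01; rewrite /=; lra.
Qed.

Lemma ccomp0 x y z (f : curve x y) (g : curve y z) : concat_fun f g 0 = x.
Proof. by rewrite /concat_fun mulr0 ifT ?curve0 ?invr_ge0. Qed.

Lemma ccomp1 x y z (f : curve x y) (g : curve y z) : concat_fun f g 1 = z.
Proof.
rewrite /concat_fun ifF; last by apply/negbTE; rewrite -ltNge; lra.
have -> : 2 * 1 - 1 = 1 :> R by ring.
by rewrite curve1.
Qed.

Definition ccomp x y z (f : curve x y) (g : curve y z) : curve x z :=
  Curve (@ccomp_cont _ _ _ f g) (ccomp0 f g) (ccomp1 f g).

Lemma ccomp_homotopic x y z (f f' : curve x y) (g g' : curve y z) :
  curve_homotopic f f' -> curve_homotopic g g' ->
  curve_homotopic (ccomp f g) (ccomp f' g').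
Proof.
move=> [H [cH H0 H1 Hx]] [K [cK K0 K1 Kx]]; exists (vpaste H K); split.
- by apply: vpaste_cont => // s s01; rewrite (Hx _ s01).2 (Kx _ s01).1.
- move=> t /in01 t01; rewrite /vpaste /= /concat_fun.
  by case: ifPn => t2; [rewrite H0|rewrite K0] => //; apply/in01;
    rewrite -?ltNge in t2; lra.
- move=> t /in01 t01; rewrite /vpaste /= /concat_fun.
  by case: ifPn => t2; [rewrite H1|rewrite K1] => //; apply/in01;
    rewrite -?ltNge in t2; lra.
- by move=> s s01; rewrite vpaste0 vpaste1 (Hx _ s01).1 (Kx _ s01).2.
Qed.

Definition hcomp x y z (a : hom x y) (b : hom y z) : hom x z :=
  cls (ccomp (repr a) (repr b)).

Lemma hcompE x y z (f : curve x y) (g : curve y z) :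
  hcomp (cls f) (cls g) = cls (ccomp f g).
Proof.
by apply/clsP; apply: ccomp_homotopic; apply/clsP; rewrite /cls reprK.
Qed.

End Curves.
Arguments curve R {T} x y.
Arguments hom R {T} x y.
Infix "\;;" := hcomp (at level 45, left associativity).

Section ConvexHomotopy.
Variables (R : realType) (E : normedModType R) (T : topologicalType).
Variables (C : set E) (f : E -> T).
Hypothesis C_convex :
  forall a b s, C a -> C b -> I01 R s -> C (a + s *: (b - a)).
Hypothesis f_cont : {within C, continuous f}.

Lemma line_in_cont (p q : R -> E) :
  {within I01 R, continuous p} -> {within I01 R, continuous q} ->
  {within I2 R, continuous (fun z => p z.2 + z.1 *: (q z.2 - p z.2))}.
Proof.
have snd_cont (r : R -> E) : {within I01 R, continuous r} ->
    {within I2 R, continuous (r \o snd)}.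
  move=> cr; apply: (@Defs.within_continuous_comp _ _ _ _ (I01 R)) => //.
    by apply: continuous_subspaceT; continuity.
  by move=> [s t] [].
move=> /snd_cont cp /snd_cont cq z.
apply: cvgD; first exact: cp.
apply: cvgZ; last by apply: cvgB; [exact: cq|exact: cp].
by apply: continuous_subspaceT; continuity.
Qed.

(** In a convex set any two curves with common endpoints are joined by the
straight-line homotopy; this single fact produces all the laws and the
commuting squares used below. *)
Lemma convex_cls_eq x y (g h : curve R x y) (p q : R -> E) :
  {within I01 R, continuous p} -> {within I01 R, continuous q} ->
  (forall t, I01 R t -> C (p t)) -> (forall t, I01 R t -> C (q t)) ->
  p 0 = q 0 -> p 1 = q 1 ->
  (forall t, I01 R t -> g t = f (p t)) ->
  (forall t, I01 R t -> h t = f (q t)) -> cls g = cls h.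
Proof.
move=> cp cq Cp Cq pq0 pq1 gE hE; apply/clsP.
exists (f \o (fun z => p z.2 + z.1 *: (q z.2 - p z.2))); split.
- apply: (@Defs.within_continuous_comp _ _ _ _ C) => //; first exact: line_in_cont.
  by move=> [s t] [/= s01 t01]; apply: C_convex => //; [exact: Cp|exact: Cq].
- by move=> t t01; rewrite /= scale0r addr0 gE.
- by move=> t t01; rewrite /= scale1r addrC subrK hE.
- have I0 : I01 R 0 by apply/in01; rewrite lexx ler01.
  have I1 : I01 R 1 by apply/in01; rewrite lexx ler01.
  move=> s _; rewrite /= pq0 pq1 !subrr !scaler0 !addr0 -!hE //.
  by rewrite curve0 curve1.
Qed.

(** Both the composite and the third curve are images of curves in [C] with the same
endpoints. *)
Lemma convex_cls_comp x y z (g : curve R x y) (h : curve R y z) (k : curve R x z)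
    (p q r : R -> E) :
  {within I01 R, continuous p} -> {within I01 R, continuous q} ->
  {within I01 R, continuous r} ->
  (forall t, I01 R t -> C (p t)) -> (forall t, I01 R t -> C (q t)) ->
  (forall t, I01 R t -> C (r t)) ->
  p 0 = r 0 -> p 1 = q 0 -> q 1 = r 1 ->
  (forall t, I01 R t -> g t = f (p t)) ->
  (forall t, I01 R t -> h t = f (q t)) ->
  (forall t, I01 R t -> k t = f (r t)) -> cls g \;; cls h = cls k.
Proof.
move=> cp cq cr Cp Cq Cr pr0 pq qr1 gE hE kE; rewrite hcompE.
pose P := Curve cp erefl pq; pose Q := Curve cq erefl erefl.
have PQ t : I01 R t -> concat_fun p q t = p (2 * t) /\ I01 R (2 * t) \/
    concat_fun p q t = q (2 * t - 1) /\ I01 R (2 * t - 1).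
  move=> /in01 t01; rewrite /concat_fun.
  by case: ifPn => t2; [left|right]; split => //; apply/in01;
    rewrite -?ltNge in t2; lra.
apply: (@convex_cls_eq _ _ _ _ (concat_fun p q) r) => //.
- exact: (@ccomp_cont _ _ _ _ _ P Q).
- by move=> t /PQ[] [-> ?]; [exact: Cp|exact: Cq].
- by rewrite (ccomp0 P Q).
- by rewrite (ccomp1 P Q).
- move=> t /in01 t01; rewrite /= /concat_fun.
  case: (lerP t 2^-1) => t2; first by rewrite gE //; apply/in01; lra.
  by rewrite hE //; apply/in01; lra.
Qed.

End ConvexHomotopy.

Section Groupoid.
Variables (R : realType) (T : topologicalType).
Implicit Types x y z w : T.

Lemma I01_convex (a b s : R^o) : I01 R a -> I01 R b -> I01 R s ->
  I01 R (a + s *: (b - a)).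
Proof.
by move=> /in01 a01 /in01 b01 /in01 s01; apply/in01; rewrite /GRing.scale /=; nra.
Qed.

(** The arc of [f] from [s] to [t], traversed backwards when [t < s].  All
groupoid laws are instances of the additivity of arcs proved in [sub_cls]. *)
Definition sub_fun (f : R -> T) (s t u : R) : T := f (s + u * (t - s)).

Lemma affine_cont (s t : R) : {within I01 R, continuous (fun u => s + u * (t - s))}.
Proof. by apply: continuous_subspaceT; continuity. Qed.

Lemma sub_cont (f : R -> T) s t : {within I01 R, continuous f} ->
  I01 R s -> I01 R t -> {within I01 R, continuous (sub_fun f s t)}.
Proof.
move=> cf s01 t01; apply: (@Defs.within_continuous_comp _ _ _ _ (I01 R)) => //.
  exact: affine_cont.
by move=> u u01; exact: (@I01_convex s t u).
Qed.

Lemma sub_fun0 (f : R -> T) s t : sub_fun f s t 0 = f s.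
Proof. by rewrite /sub_fun mul0r addr0. Qed.

Lemma sub_fun1 (f : R -> T) s t : sub_fun f s t 1 = f t.
Proof. by rewrite /sub_fun mul1r addrC subrK. Qed.

Definition subcurve (f : R -> T) (cf : {within I01 R, continuous f}) s t
    (hs : I01 R s) (ht : I01 R t) : curve R (f s) (f t) :=
  Curve (sub_cont cf hs ht) (sub_fun0 f s t) (sub_fun1 f s t).

Lemma sub_cls (f : R -> T) (cf : {within I01 R, continuous f}) (s t u : R)
    x y z (g : curve R x y) (h : curve R y z) (k : curve R x z) :
  I01 R s -> I01 R t -> I01 R u ->
  (forall v, I01 R v -> g v = sub_fun f s t v) ->
  (forall v, I01 R v -> h v = sub_fun f t u v) ->
  (forall v, I01 R v -> k v = sub_fun f s u v) ->
  cls g \;; cls h = cls k.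
Proof.
move=> s01 t01 u01 gE hE kE.
apply: (@convex_cls_comp R R^o T (I01 R) f I01_convex cf _ _ _ _ _ _
   (fun v => s + v * (t - s)) (fun v => t + v * (u - t))
   (fun v => s + v * (u - s))) => //.
- exact: affine_cont.
- exact: affine_cont.
- exact: affine_cont.
- by move=> v; exact: I01_convex.
- by move=> v; exact: I01_convex.
- by move=> v; exact: I01_convex.
- by rewrite !mul0r.
- by rewrite mul1r mul0r addr0 addrC subrK.
- by rewrite !mul1r ![_ + (_ - _)]addrC !subrK.
Qed.

Lemma I010 : I01 R 0. Proof. by apply/in01; rewrite lexx ler01. Qed.
Lemma I011 : I01 R 1. Proof. by apply/in01; rewrite lexx ler01. Qed.
Hint Resolve I010 I011 : core.

Definition cid (x : T) : curve R x x :=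
  Curve (@cst_cont R T x) erefl erefl.

Lemma crev_cont x y (f : curve R x y) : {within I01 R, continuous (sub_fun f 1 0)}.
Proof. by apply: sub_cont => //; exact: curve_cont. Qed.

Lemma crev0 x y (f : curve R x y) : sub_fun f 1 0 0 = y.
Proof. by rewrite sub_fun0 curve1. Qed.

Lemma crev1 x y (f : curve R x y) : sub_fun f 1 0 1 = x.
Proof. by rewrite sub_fun1 curve0. Qed.

Definition crev x y (f : curve R x y) : curve R y x :=
  Curve (@crev_cont x y f) (crev0 f) (crev1 f).

Definition hid (x : T) : hom R x x := cls (cid x).
Definition hinv x y (a : hom R x y) : hom R y x := cls (crev (repr a)).

Lemma hom_ind x y (P : hom R x y -> Prop) : (forall f, P (cls f)) -> forall a, P a.
Proof. by move=> Pf; elim/quotW. Qed.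

Lemma sub01 x y (f : curve R x y) v : f v = sub_fun f 0 1 v.
Proof. by rewrite /sub_fun add0r subr0 mulr1. Qed.

Lemma sub_id (f : R -> T) s v : sub_fun f s s v = f s.
Proof. by rewrite /sub_fun subrr mulr0 addr0. Qed.

Lemma hcomp1g x y (a : hom R x y) : hid x \;; a = a.
Proof.
elim/hom_ind: a => f.
apply: (@sub_cls f (@curve_cont _ _ _ _ f) 0 0 1) => // v _.
- by rewrite sub_id curve0.
- exact: sub01.
- exact: sub01.
Qed.

Lemma hcompg1 x y (a : hom R x y) : a \;; hid y = a.
Proof.
elim/hom_ind: a => f.
apply: (@sub_cls f (@curve_cont _ _ _ _ f) 0 1 1) => // v _.
- exact: sub01.
- by rewrite sub_id curve1.
- exact: sub01.
Qed.

Lemma hcompgV x y (a : hom R x y) : a \;; hinv a = hid x.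
Proof.
rewrite -[X in X \;; _]reprK; set f := repr a.
apply: (@sub_cls f (@curve_cont _ _ _ _ f) 0 1 0) => // v _.
- exact: sub01.
- by rewrite sub_id curve0.
Qed.

Lemma hcompVg x y (a : hom R x y) : hinv a \;; a = hid y.
Proof.
rewrite -[X in _ \;; X]reprK; set f := repr a.
apply: (@sub_cls f (@curve_cont _ _ _ _ f) 1 0 1) => // v _.
- exact: sub01.
- by rewrite sub_id curve1.
Qed.

(** All three curves are arcs of their concatenation [F]. *)
Lemma hcompA w x y z (a : hom R w x) (b : hom R x y) (c : hom R y z) :
  a \;; (b \;; c) = a \;; b \;; c.
Proof.
elim/hom_ind: a => f; elim/hom_ind: b => g; elim/hom_ind: c => h.
pose F := ccomp f (ccomp g h); have cF := @curve_cont _ _ _ _ F.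
have sF (s t : R) : I01 R s -> I01 R t ->
    {within I01 R, continuous (sub_fun F s t)} by exact: sub_cont.
have i2 : I01 R 2^-1 by apply/in01; lra.
have i4 : I01 R (3 / 4) by apply/in01; lra.
have fE v : I01 R v -> f v = sub_fun F 0 2^-1 v.
  move=> /in01 v01; rewrite /sub_fun /= /concat_fun ifT; last by lra.
  by congr (f _); lra.
have ghE v : I01 R v -> ccomp g h v = sub_fun F 2^-1 1 v.
  move=> /in01 v01; rewrite [RHS]/sub_fun /= [RHS]/concat_fun.
  case: ifPn => v2.
    have -> : v = 0 by lra.
    rewrite ccomp0; have -> : 2 * (2^-1 + 0 * (1 - 2^-1)) = 1 :> R by lra.
    by rewrite curve1.
  by congr (concat_fun g h _); lra.
have gE v : I01 R v -> g v = sub_fun F 2^-1 (3 / 4) v.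
  move=> /in01 v01.
  have -> : sub_fun F 2^-1 (3 / 4) v = sub_fun F 2^-1 1 (v / 2).
    by rewrite /sub_fun; congr (F _); lra.
  rewrite -ghE; last by apply/in01; lra.
  by rewrite /= /concat_fun ifT; [congr (g _)|]; lra.
have hE v : I01 R v -> h v = sub_fun F (3 / 4) 1 v.
  move=> /in01 v01.
  have -> : sub_fun F (3 / 4) 1 v = sub_fun F 2^-1 1 ((v + 1) / 2).
    by rewrite /sub_fun; congr (F _); lra.
  rewrite -ghE; last by apply/in01; lra.
  rewrite /= /concat_fun; case: ifPn => v2.
    have -> : v = 0 by lra.
    have -> : 2 * ((0 + 1) / 2) = 1 :> R by lra.
    by rewrite curve0 curve1.
  by congr (h _); lra.
have F34 : sub_fun F 0 (3 / 4) 1 = y.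
  transitivity (g 1); last exact: curve1.
  by rewrite gE // /sub_fun; congr (F _); lra.
have F340 : sub_fun F 0 (3 / 4) 0 = w by rewrite /sub_fun mul0r addr0 curve0.
pose FG := Curve (sF _ _ I010 i4) F340 F34.
have -> : cls f \;; cls g = cls FG.
  exact: (@sub_cls F cF 0 2^-1 (3 / 4)).
have -> : cls FG \;; cls h = cls F.
  by apply: (@sub_cls F cF 0 (3 / 4) 1) => // v _; exact: sub01.
by rewrite !hcompE.
Qed.

Lemma hcomp_inj x y z (a b : hom R x y) (c : hom R y z) :
  a \;; c = b \;; c -> a = b.
Proof.
by move=> /(congr1 (fun d => d \;; hinv c)); rewrite -!hcompA hcompgV !hcompg1.
Qed.

Lemma hcomp_injl x y z (a b : hom R y z) (c : hom R x y) :
  c \;; a = c \;; b -> a = b.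
Proof.
by move=> /(congr1 (fun d => hinv c \;; d)); rewrite !hcompA hcompVg !hcomp1g.
Qed.

Lemma square_convex (a b : R^o * R^o) (s : R) :
  I2 R a -> I2 R b -> I01 R s -> I2 R (a + s *: (b - a)).
Proof.
by move: a b => [a1 a2] [b1 b2] [/= ? ?] [/= ? ?] s01; split; exact: I01_convex.
Qed.

(** Both composites are images of curves in the square with the same endpoints, so they
equal the class of the diagonal. *)
Lemma square_cls (K : R * R -> T) (cK : {within I2 R, continuous K})
    w x y z (f : curve R w x) (g : curve R y z) (l : curve R w y) (r : curve R x z) :
  (forall t, I01 R t -> f t = K (0, t)) ->
  (forall t, I01 R t -> g t = K (1, t)) ->
  (forall s, I01 R s -> l s = K (s, 0)) ->
  (forall s, I01 R s -> r s = K (s, 1)) ->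
  cls f \;; cls r = cls l \;; cls g.
Proof.
move=> fE gE lE rE; pose d t := K (t, t).
have cd : {within I01 R, continuous d}.
  apply: (@Defs.within_continuous_comp _ _ _ _ (I2 R) K (fun t => (t, t))) => //.
  by apply: continuous_subspaceT; continuity.
have d0 : d 0 = w by rewrite /d -fE // curve0.
have d1 : d 1 = z by rewrite /d -gE // curve1.
transitivity (cls (Curve cd d0 d1)).
  apply: (@convex_cls_comp R (R^o * R^o)%type T (I2 R) K square_convex cK
    _ _ _ _ _ _ (fun t => (0, t)) (fun t => (t, 1)) (fun t => (t, t))) => //;
    by apply: continuous_subspaceT; continuity.
symmetry; apply: (@convex_cls_comp R (R^o * R^o)%type T (I2 R) K square_convex cK
    _ _ _ _ _ _ (fun t => (t, 0)) (fun t => (1, t)) (fun t => (t, t))) => //;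
    by apply: continuous_subspaceT; continuity.
Qed.

End Groupoid.

Section Functoriality.
Variables (R : realType) (S T : topologicalType) (f : S -> T).
Hypothesis f_cont : continuous f.

Lemma cmap_cont x y (g : curve R x y) : {within I01 R, continuous (f \o g)}.
Proof.
apply: (@Defs.within_continuous_comp _ _ _ _ setT) => //; last exact: curve_cont.
exact: continuous_subspaceT.
Qed.

Lemma cmap0 x y x' (g : curve R x y) : f x = x' -> (f \o g) 0 = x'.
Proof. by rewrite /= curve0. Qed.

Lemma cmap1 x y y' (g : curve R x y) : f y = y' -> (f \o g) 1 = y'.
Proof. by rewrite /= curve1. Qed.

Definition cmap x y x' y' (fx : f x = x') (fy : f y = y') (g : curve R x y) :
  curve R x' y' := Curve (@cmap_cont _ _ g) (cmap0 g fx) (cmap1 g fy).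

Lemma cmap_cls x y x' y' (fx : f x = x') (fy : f y = y') (g h : curve R x y) :
  cls g = cls h -> cls (cmap fx fy g) = cls (cmap fx fy h).
Proof.
move=> /clsP[H [cH H0 H1 Hx]]; apply/clsP; exists (f \o H); split => /=.
- apply: (@Defs.within_continuous_comp _ _ _ _ setT) => //.
  exact: continuous_subspaceT.
- by move=> t t01; rewrite H0.
- by move=> t t01; rewrite H1.
- by move=> s s01; rewrite (Hx _ s01).1 (Hx _ s01).2 fx fy.
Qed.

End Functoriality.
(** * Polar coordinates in the plane *)

Section Polar.
Variable R : realType.
Implicit Types a t r : R.

(** The first argument is the squared radius and the second the angle in turns, as in the
moment map and the torus [R^n / Z^n]. *)
Definition polar a t : R * R :=
  (Num.sqrt a * cos (2 * pi * t), Num.sqrt a * sin (2 * pi * t)).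

Definition sqmod (w : R * R) : R := w.1 ^+ 2 + w.2 ^+ 2.

Lemma sqmod_polar a t : 0 <= a -> sqmod (polar a t) = a.
Proof.
move=> a0; rewrite /sqmod /polar /= !exprMn sqr_sqrtr // -mulrDr.
by rewrite cos2Dsin2 mulr1.
Qed.

Lemma polar0 t : polar 0 t = 0.
Proof. by rewrite /polar sqrtr0 !mul0r. Qed.

Lemma polar_cont : continuous (fun z : R * R => polar z.1 z.2).
Proof.
have ca : continuous (fun z : R * R => 2 * pi * z.2) by continuity.
have cs : continuous (fun z : R * R => Num.sqrt z.1).
  by move=> z; apply: continuous_comp; [exact: continuous_fst|exact: sqrt_continuous].
apply: continuous_pair; apply: continuous_mulr => //.
  by move=> z; apply: continuous_comp; [exact: ca|exact: continuous_cos].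
by move=> z; apply: continuous_comp; [exact: ca|exact: continuous_sin].
Qed.

(** After removal of the integer part, the cosine is injective on each half turn. *)
Lemma cos2pi_eq1 t : cos (2 * pi * t) = 1 -> exists z : int, t = z%:~R.
Proof.
move=> c1; exists (Num.floor t); apply/eqP; rewrite -subr_eq0.
set d := t - _.
have td : t = d + (Num.floor t)%:~R by rewrite subrK.
have cd : cos (2 * pi * d) = 1.
  rewrite -(periodic_intr d (Num.floor t) (@cosD2pi R)). by rewrite -td c1.
have d0 : 0 <= d by rewrite subr_ge0 floor_le_tmp.
have d1 : d < 1 by rewrite ltrBlDl -(intrD1 _) floorD1_gt.
have p0 := @pi_gt0 R.
apply/eqP; case: (leP d 2^-1) => d2.
  have /cos_inj : cos (2 * pi * d) = cos 0 by rewrite cos0.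
  rewrite !in_itv /= lexx pi_ge0 => /(_ _ isT) H.
  have : 2 * pi * d = 0 by apply: H; apply/andP; split; nra.
  by move=> /eqP; rewrite !mulf_eq0 pnatr_eq0 (gt_eqF p0) /= => /eqP.
have cd' : cos (2 * pi * (1 - d)) = 1.
  rewrite -[RHS]cd -[RHS]cosN -[RHS](cosD2pi); congr cos.
  by rewrite mulr2n; ring.
have /cos_inj : cos (2 * pi * (1 - d)) = cos 0 by rewrite cos0.
rewrite !in_itv /= lexx pi_ge0 => /(_ _ isT) H.
have : 2 * pi * (1 - d) = 0 by apply: H; apply/andP; split; nra.
by nra.
Qed.

Lemma polar_eq a t t' : 0 < a -> polar a t = polar a t' ->
  exists z : int, t' - t = z%:~R.
Proof.
move=> a0 [ec es]; apply: cos2pi_eq1.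
have s0 : Num.sqrt a != 0 by rewrite gt_eqF // sqrtr_gt0.
rewrite mulrBr cosB -(mulfI s0 ec) -(mulfI s0 es) -!expr2.
exact: cos2Dsin2.
Qed.

(** Away from the origin a local angle is given by the arctangent in a rotated frame. *)
Lemma polar_arg a0 t0 e : 0 < a0 -> 0 < e ->
  \forall w \near polar a0 t0, exists2 t, `|t - t0| < e & w = polar (sqmod w) t.
Proof.
move=> a0_gt0 e_gt0; set c := cos (2 * pi * t0); set s := sin (2 * pi * t0).
have cs : c ^+ 2 + s ^+ 2 = 1 by exact: cos2Dsin2.
(* the coordinates of w in the frame rotated by the angle t0 *)
pose u (w : R * R) := w.1 * c + w.2 * s; pose v (w : R * R) := w.2 * c - w.1 * s.
have cu : continuous u by rewrite /u; continuity.
have cv : continuous v by rewrite /v; continuity.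
have r0 : 0 < Num.sqrt a0 by rewrite sqrtr_gt0.
have u0 : u (polar a0 t0) = Num.sqrt a0.
  transitivity (Num.sqrt a0 * (c ^+ 2 + s ^+ 2)); last by rewrite cs mulr1.
  by rewrite /u /polar /= -/c -/s; ring.
have v0 : v (polar a0 t0) = 0.
  by rewrite /v /polar /= -/c -/s; ring.
pose th w := atan (v w / u w) / (2 * pi).
have p0 := @pi_gt0 R.
have p20 : (2 * pi : R) != 0 by rewrite gt_eqF // mulr_gt0.
have u_near : \forall w \near polar a0 t0, 0 < u w.
  have cu0 : u @ polar a0 t0 --> u (polar a0 t0) by exact: cu.
  by apply: (cvgr_gt (u (polar a0 t0)) cu0); rewrite u0.
have th_near : \forall w \near polar a0 t0, `|th w| < e.
  have cth : th @ polar a0 t0 --> th (polar a0 t0).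
    apply: cvgM; last exact: cvg_cst.
    apply: (@continuous_comp _ _ _ (fun w => v w / u w) atan);
      last exact: continuous_atan.
    by apply: cvgM; [exact: cv|apply: cvgV; [rewrite u0 gt_eqF|exact: cu]].
  have th0 : th (polar a0 t0) = 0 by rewrite /th v0 mul0r atan0 mul0r.
  by rewrite th0 in cth; exact: (cvgr0_norm_lt _ cth).
near=> w.
have uw : 0 < u w by near: w.
exists (t0 + th w); first by rewrite addrAC subrr add0r; near: w.
have thE : 2 * pi * th w = atan (v w / u w).
  by rewrite /th mulrCA mulfV // mulr1.
set q := v w / u w in thE.
have vq : v w = q * u w by rewrite /q mulfVK // gt_eqF.
have sq : sqmod w = u w ^+ 2 * (1 + q ^+ 2).
  have -> : u w ^+ 2 * (1 + q ^+ 2) = u w ^+ 2 + v w ^+ 2 by rewrite vq; ring.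
  have -> : u w ^+ 2 + v w ^+ 2 = sqmod w * (c ^+ 2 + s ^+ 2).
    by rewrite /u /v /sqmod; ring.
  by rewrite cs mulr1.
have q1 : 0 < 1 + q ^+ 2 by rewrite ltr_pwDl // sqr_ge0.
have ss : Num.sqrt (sqmod w) = u w * Num.sqrt (1 + q ^+ 2).
  by rewrite sq sqrtrM ?sqr_ge0 // sqrtr_sqr ger0_norm // ltW.
have Q0 : Num.sqrt (1 + q ^+ 2) != 0 by rewrite gt_eqF // sqrtr_gt0.
have ca : cos (atan q) = (Num.sqrt (1 + q ^+ 2))^-1 by exact: cos_atan.
have sa : sin (atan q) = q * (Num.sqrt (1 + q ^+ 2))^-1.
  have cn : cos (atan q) != 0 by rewrite ca invr_neq0.
  transitivity (tan (atan q) * cos (atan q)); last by rewrite atanK ca.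
  by rewrite /tan mulfVK.
rewrite /polar ss mulrDr thE cosD sinD -/c -/s ca sa [LHS]surjective_pairing.
have K x : u w * Num.sqrt (1 + q ^+ 2) * (x * (Num.sqrt (1 + q ^+ 2))^-1) = u w * x.
  by field.
congr (_, _).
- have -> : c * (Num.sqrt (1 + q ^+ 2))^-1 - s * (q * (Num.sqrt (1 + q ^+ 2))^-1) =
     (c - s * q) * (Num.sqrt (1 + q ^+ 2))^-1 by ring.
  rewrite K mulrBr [u w * (s * q)]mulrCA [u w * q]mulrC -vq /u /v.
  have -> : (w.1 * c + w.2 * s) * c - s * (w.2 * c - w.1 * s) =
    w.1 * (c ^+ 2 + s ^+ 2) by ring.
  by rewrite cs mulr1.
- have -> : s * (Num.sqrt (1 + q ^+ 2))^-1 + c * (q * (Num.sqrt (1 + q ^+ 2))^-1) =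
     (s + c * q) * (Num.sqrt (1 + q ^+ 2))^-1 by ring.
  rewrite K mulrDr [u w * (c * q)]mulrCA [u w * q]mulrC -vq /u /v.
  have -> : (w.1 * c + w.2 * s) * s + c * (w.2 * c - w.1 * s) =
    w.2 * (c ^+ 2 + s ^+ 2) by ring.
  by rewrite cs mulr1.
Unshelve. all: by end_near. Qed.

(** At the origin the angle is undetermined but harmless, since small discs are
invariant under rotation; elsewhere it can be chosen close to that of the
centre.  So in both cases nearby points have polar coordinates in a fixed
convex set. *)
Lemma polar_local a0 t0 r : 0 <= a0 -> 0 < r -> exists d : R, [/\ 0 < d,
  forall a t, 0 <= a -> `|a - a0| < d -> (0 < a0 -> `|t - t0| < d) ->
    ball (polar a0 t0) r (polar a t) &
  \forall w \near polar a0 t0, `|sqmod w - a0| < d /\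
    forall t, w = polar (sqmod w) t -> exists2 t',
      0 < a0 -> `|t' - t0| < d & w = polar (sqmod w) t'].
Proof.
move=> a0_ge0 r0.
have sq_near d : 0 < d -> \forall w \near polar a0 t0, `|sqmod w - a0| < d.
  move=> d0; have csq : continuous sqmod by rewrite /sqmod; continuity.
  have csq0 : sqmod w @[w --> polar a0 t0] --> a0.
    by rewrite -[X in _ --> X](sqmod_polar t0 a0_ge0); exact: csq.
  have : (fun w => sqmod w - a0) @ polar a0 t0 --> 0.
    by rewrite -(subrr a0); apply: cvgB => //; exact: cvg_cst.
  by move=> /cvgr0_norm_lt; apply.
have := a0_ge0; rewrite le_eqVlt => /predU1P[a00|a0_gt0].
  exists (r ^+ 2); split; first by rewrite exprn_gt0.
    move=> a t a_ge0; rewrite -a00 subr0 ger0_norm // => ar _.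
    have sr : Num.sqrt a < r.
      by rewrite -(ger0_norm (ltW r0)) -sqrtr_sqr ltr_sqrt // exprn_gt0.
    rewrite polar0; split => /=; rewrite /ball /= sub0r normrN normrM
      (ger0_norm (sqrtr_ge0 _)) (le_lt_trans _ sr) // ler_piMr ?sqrtr_ge0 //.
      exact: cos_max.
    exact: sin_max.
  have := sq_near _ (exprn_gt0 2 r0); apply: filterS => w ->; split=> // t wt.
  by exists t => //; rewrite -a00 ltxx.
have [d /= d0 dP] : exists2 d : R, 0 < d &
    forall a t, `|a - a0| < d -> `|t - t0| < d -> ball (polar a0 t0) r (polar a t).
  have := @polar_cont (a0, t0) _ (nbhsx_ballx _ _ r0).
  move=> /nbhs_ballP[d d0 dP]; exists d => // a t ad td.
  by apply: (dP (a, t)); split; rewrite /ball /= distrC.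
exists d; split => //; first by move=> a t _ ad /(_ a0_gt0); exact: dP.
near=> w; split; first by near: w; exact: sq_near.
have [t' t'd wE] : exists2 t', `|t' - t0| < d & w = polar (sqmod w) t'.
  by near: w; exact: polar_arg.
by move=> _ _; exists t'.
Unshelve. all: by end_near. Qed.

End Polar.
(** * Polar coordinates on C^n *)

Section ComplexPolar.
Variables (R : realType) (n : nat).
Implicit Types (xi x : 'rV[R]_n) (z : 'rV[R]_(n * 2)).

Definition coords z (i : 'I_n) : R * R := (re_part z i, im_part z i).

Definition cpolar xi x : 'rV[R]_(n * 2) := nu_C xi (\pi_(torus R n) x).

Lemma cpolar_mxvec xi x : cpolar xi x = mxvec (\matrix_(i < n, j < 2)
  (if j == 0 then (polar (xi 0 i) (x 0 i)).1 else (polar (xi 0 i) (x 0 i)).2)).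
Proof.
rewrite /cpolar nu_CE; congr mxvec; apply/matrixP => i j; rewrite !mxE.
by case: ifP.
Qed.

Lemma coords_cpolar xi x i : coords (cpolar xi x) i = polar (xi 0 i) (x 0 i).
Proof. by rewrite /coords /re_part /im_part cpolar_mxvec !mxvecE !mxE. Qed.

Lemma coords_inj z z' : (forall i, coords z i = coords z' i) -> z = z'.
Proof.
move=> zz'; apply/rowP => k; case/mxvec_indexP: k => i j.
have [E0 E1] := zz' i; rewrite /re_part /im_part in E0 E1.
have [->//|->//] : j = 0 \/ j = 1.
by case: j => [[|[|//]]] lt_j; [left|right]; exact: val_inj.
Qed.

Lemma mu_CE z i : mu_C z 0 i = sqmod (coords z i).
Proof. by rewrite mxE. Qed.

Lemma mu_C_cpolar xi x : orthant xi -> mu_C (cpolar xi x) = xi.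
Proof.
by move=> xi0; apply/rowP => i; rewrite mu_CE coords_cpolar sqmod_polar.
Qed.

Lemma mu_C_ge0 z : orthant (mu_C z).
Proof. by move=> i; rewrite mu_CE addr_ge0 // sqr_ge0. Qed.

Lemma coords_cont i : continuous (fun z => coords z i).
Proof. by apply: continuous_pair => z; exact: coord_continuous. Qed.

Lemma mu_C_cont : continuous (@mu_C R n).
Proof.
apply: rV_continuous => i z.
rewrite (_ : (fun _ => _) = fun z => sqmod (coords z i)).
  have csq : continuous (@sqmod R) by rewrite /sqmod; continuity.
  by apply: (@continuous_comp _ _ _ (fun z => coords z i) (@sqmod R));
    [exact: coords_cont|exact: csq].
by apply: boolp.funext => z'; exact: mu_CE.
Qed.

Lemma cpolar_cont : continuous (fun w : 'rV[R]_n * 'rV[R]_n => cpolar w.1 w.2).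
Proof.
have cp i : continuous (fun w : 'rV[R]_n * 'rV[R]_n => polar (w.1 0 i) (w.2 0 i)).
  have cw : continuous (fun w : 'rV[R]_n * 'rV[R]_n => (w.1 0 i, w.2 0 i)).
    apply: continuous_pair => w.
      by apply: (@continuous_comp _ _ _ fst (fun M : 'rV[R]_n => M 0 i));
        [exact: continuous_fst|exact: coord_continuous].
    by apply: (@continuous_comp _ _ _ snd (fun M : 'rV[R]_n => M 0 i));
      [exact: continuous_snd|exact: coord_continuous].
  by move=> w; exact: (continuous_comp (cw w) (@polar_cont R _)).
apply: rV_continuous => k; case/mxvec_indexP: k => i j w.
rewrite (_ : (fun _ => _) = fun w : 'rV[R]_n * 'rV[R]_n =>
  if j == 0 then (polar (w.1 0 i) (w.2 0 i)).1 else (polar (w.1 0 i) (w.2 0 i)).2).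
  case: (j == 0).
    exact: (continuous_comp (cp i w) (@continuous_fst _ _ _)).
  exact: (continuous_comp (cp i w) (@continuous_snd _ _ _)).
by apply: boolp.funext => w'; rewrite cpolar_mxvec mxvecE mxE.
Qed.

Lemma dist_convex (a b c d s : R) : I01 R s -> `|a - c| < d -> `|b - c| < d ->
  `|a + s * (b - a) - c| < d.
Proof.
move=> /in01 /andP[s0 s1]; rewrite !ltr_norml => /andP[? ?] /andP[? ?].
have [->|s1'] := eqVneq s 1; first by rewrite mul1r; apply/andP; split; lra.
have {s1'}s1 : 0 < 1 - s by rewrite subr_gt0 lt_neqAle s1' s1.
by apply/andP; split; nra.
Qed.

(** The set [K] consists of the polar coordinates near [(xi0, x0)], with no condition on
the angles of the vanishing coordinates.  Its convexity lets two points near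
[cpolar xi0 x0] be joined by a curve that is linear in polar coordinates. *)
Lemma cpolar_local xi0 x0 (N : set 'rV[R]_(n * 2)) : orthant xi0 ->
  nbhs (cpolar xi0 x0) N -> exists K : set ('rV[R]_n * 'rV[R]_n),
  [/\ forall a b s, K a -> K b -> I01 R s -> K (a + s *: (b - a)),
      forall w, K w -> orthant w.1 /\ N (cpolar w.1 w.2) &
      \forall z \near cpolar xi0 x0, forall x, z = cpolar (mu_C z) x ->
        exists2 x', K (mu_C z, x') & z = cpolar (mu_C z) x'].
Proof.
move=> xi0_ge0 /nbhs_ballP[r /= r0 rN].
have /boolp.choice[d dP] i := polar_local (x0 0 i) (xi0_ge0 i) r0.
exists [set w : 'rV[R]_n * 'rV[R]_n | forall i, [/\ 0 <= w.1 0 i, `|w.1 0 i - xi0 0 i| < d i &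
                0 < xi0 0 i -> `|w.2 0 i - x0 0 i| < d i]]; split.
- move=> [a1 a2] [b1 b2] s Ka Kb s01 i.
  have [/= ? ? Ka2] := Ka i; have [/= ? ? Kb2] := Kb i.
  rewrite !mxE; split; [|exact: dist_convex|].
    by move/in01: s01 => /andP[? ?]; nra.
  by move=> /[dup] /Ka2 ? /Kb2 ?; exact: dist_convex.
- move=> [xi x] Kw; split; first by move=> i; have [] := Kw i.
  apply: rN; split => //= j k; rewrite ord1 {j}; case/mxvec_indexP: k => i j.
  have [_ dB _] := dP i; have [w0 w1 w2] := Kw i.
  have := dB _ _ w0 w1 w2 => -[/= B1 B2].
  by rewrite !cpolar_mxvec !mxvecE !mxE; case: ifP.
- pose Q i (w : R * R) := `|sqmod w - xi0 0 i| < d i /\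
    forall t, w = polar (sqmod w) t -> exists2 t',
      0 < xi0 0 i -> `|t' - x0 0 i| < d i & w = polar (sqmod w) t'.
  have Qnear i : \forall z \near cpolar xi0 x0, Q i (coords z i).
    have [_ _ Qi] := dP i; rewrite -coords_cpolar in Qi.
    exact: (@coords_cont i (cpolar xi0 x0) _ Qi).
  have : \forall z \near cpolar xi0 x0, forall i, Q i (coords z i).
    exact: (@filter_forall _ _ (fun i z => Q i (coords z i)) _
      (nbhs_filter (cpolar xi0 x0)) Qnear).
  apply: filterS => z Hz x zx.
  have /boolp.choice[g gP] : forall i, exists t, (0 < xi0 0 i -> `|t - x0 0 i| < d i) /\
      coords z i = polar (sqmod (coords z i)) t.
    move=> i; have [_] := Hz i; move=> /(_ (x 0 i)) [|t' ? ?]; last by exists t'.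
    by rewrite {1}zx coords_cpolar mu_CE.
  exists (\row_i g i).
    move=> i /=; rewrite mu_CE [(\row__ _) _ _]mxE; split.
    - by rewrite -mu_CE; exact: mu_C_ge0.
    - by have [] := Hz i.
    - by have [] := gP i.
  apply: coords_inj => i; rewrite coords_cpolar mu_CE mxE.
  by have [] := gP i.
Qed.

End ComplexPolar.
(** * Charts centred at a corner *)

Section Corner.
Variable R : realType.

Lemma is_derive_line n (f : 'rV[R]_n -> R^o) (c v : 'rV[R]_n) (s : R) :
  derivable f (s *: v + c) v ->
  is_derive s (1 : R) (fun u : R => f (u *: v + c)) ('D_v f (s *: v + c)).
Proof.
have E : (fun h : R => h^-1 *: (((fun u : R => f (u *: v + c)) \o shift s) (h *: (1 : R^o)) -
      (fun u : R => f (u *: v + c)) s)) =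
    (fun h : R => h^-1 *: ((f \o shift (s *: v + c)) (h *: v) - f (s *: v + c))).
  apply: boolp.funext => h /=; rewrite [h *: (1 : R^o)]mulr1.
  by rewrite scalerDl addrA.
by move=> df; apply: DeriveDef; rewrite /derivable /derive E.
Qed.

(** The mean value inequality along a line. *)
Lemma line_bound n (f : 'rV[R]_n -> R^o) (c v : 'rV[R]_n) (M d : R) :
  (forall s, `|s| < d -> derivable f (s *: v + c) v /\
     `|'D_v f (s *: v + c)| <= M) ->
  forall s, `|s| < d -> `|f (s *: v + c) - f c| <= M * `|s|.
Proof.
move=> df s sd; pose phi u := f (u *: v + c).
have phi' u : `|u| < d -> is_derive u (1 : R) phi ('D_v f (u *: v + c)).
  by move=> /df[? _]; exact: is_derive_line.
have cphi a b : (forall u, a <= u <= b -> `|u| < d) ->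
    {within `[a, b], continuous phi}.
  move=> abd; apply: derivable_within_continuous => u; rewrite in_itv /= => /abd.
  by move=> /phi'[].
have -> : f c = phi 0 by rewrite /phi scale0r add0r.
have [s0|s0] := leP 0 s.
  have sin u : 0 <= u <= s -> `|u| < d.
    by move=> /andP[u0 us]; rewrite ger0_norm // (le_lt_trans us) // -(ger0_norm s0).
  have dphi u : u \in `]0, s[ -> is_derive u (1 : R) phi ('D_v f (u *: v + c)).
    by rewrite in_itv /= => /andP[/ltW u0 /ltW us]; apply/phi'/sin; rewrite u0.
  have [u us ->] := MVT_segment s0 dphi (cphi _ _ sin).
  rewrite subr0 normrM ler_wpM2r //.
  by have [] := df u; [exact: sin|].
have s0' := ltW s0.
have sin u : s <= u <= 0 -> `|u| < d.
  move=> /andP[su u0]; rewrite ler0_norm // (le_lt_trans _ sd) //.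
  by rewrite ler0_norm // lerN2.
have dphi u : u \in `]s, 0[ -> is_derive u (1 : R) phi ('D_v f (u *: v + c)).
  by rewrite in_itv /= => /andP[/ltW su /ltW u0]; apply/phi'/sin; rewrite su.
have [u us E] := MVT_segment s0' dphi (cphi _ _ sin).
rewrite -normrN opprB E sub0r normrM normrN ler_wpM2r //.
by have [] := df u; [exact: sin|].
Qed.

(** The segment from [a] to [w] is replaced by a chain of segments parallel to the
axes, on each of which only one partial derivative occurs. *)
Lemma C1_bound n (U : set 'rV[R]_n) (f : 'rV[R]_n -> R) a :
  open U -> U a -> Ck 1 U f -> exists M : 'I_n -> R,
  \forall w \near a, `|f w - f a| <= \sum_k M k * `|w 0 k - a 0 k|.
Proof.
move=> oU Ua [_ df]; pose D k x := 'D_(delta_mx 0 k) (f : _ -> R^o) x.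
exists (fun k => `|D k a| + 1).
have : \forall w \near a, U w /\ forall k, `|D k w| <= `|D k a| + 1.
  have nU : \forall w \near a, U w by apply: open_nbhs_nbhs; split.
  have nD k : \forall w \near a, `|D k w| <= `|D k a| + 1.
    have [_ [cD _]] := df k.
    have cDa : D k w @[w --> a] --> D k a by apply: cD; rewrite inE.
    have lt1 : `|D k a| < `|D k a| + 1 by rewrite ltrDl.
    apply: (@filterS _ (nbhs a) (nbhs_filter a) _ _ _ (cvgr_norm_lt _ cDa _ lt1)).
    by move=> w; exact: ltW.
  apply: filterI => //.
  exact: (@filter_forall _ _ (fun k w => `|D k w| <= `|D k a| + 1) _
    (nbhs_filter a) nD).
move=> /nbhs_ballP[d /= d0 dP]; apply/nbhs_ballP; exists d => //= w aw.
have awk k : `|w 0 k - a 0 k| < d.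
  by have [_ /(_ 0 k)] := aw; rewrite /ball /= distrC.
(* h k agrees with w on the first k coordinates and with a on the others *)
pose h (k : nat) : 'rV[R]_n := \row_j (if (j < k)%N then w 0 j else a 0 j).
have h0 : h 0 = a by apply/rowP => j; rewrite mxE.
have hn : h n = w by apply/rowP => j; rewrite mxE ltn_ord.
have hS (k : 'I_n) : h k.+1 = (w 0 k - a 0 k) *: delta_mx 0 k + h k.
  apply/rowP => j; rewrite !mxE eqxx /= ltnS leq_eqVlt.
  have [->|jk] := eqVneq j k; first by rewrite eqxx /= ltnn mulr1 subrK.
  have -> : (j == k :> nat) = false by apply/negbTE.
  by rewrite mulr0 add0r.
have hd (k : 'I_n) s : `|s| < d -> ball a d (s *: delta_mx 0 k + h k).
  move=> sd; split => // i j; rewrite ord1 /ball /= !mxE eqxx /=.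
  have [->|jk] := eqVneq j k.
    by rewrite ltnn mulr1 opprD addrCA subrr addr0 normrN.
  rewrite mulr0 add0r; case: ifP => _; last by rewrite subrr normr0.
  by rewrite distrC.
rewrite -{1}hn -{1}h0 -(@telescope_sumr _ 0 n (fun k => f (h k))) // big_mkord.
rewrite (le_trans (ler_norm_sum _ _ _)) //; apply: ler_sum => k _.
rewrite hS; apply: (@line_bound n f (h k) (delta_mx 0 k) _ d) => // s sd.
have [Us Ds] := dP _ (hd k s sd); split; last exact: Ds.
by have [+ _] := df k; apply.
Qed.

Lemma line_cvg n (a v : 'rV[R]_n) : t *: v + a @[t --> (0 : R)] --> a.
Proof.
have c : continuous (fun t : R => a + t *: v) by apply: affine_rV_continuous => t; exact: cvg_id.
rewrite -[X in _ --> X]addr0 -(scale0r v).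
rewrite (_ : (fun _ => _) = fun t : R => a + t *: v); first exact: c.
by apply: boolp.funext => t; rewrite addrC.
Qed.

(** At a local minimum along a line the directional derivative vanishes. *)
Lemma C1_min_small n (U : set 'rV[R]_n) (f : 'rV[R]_n -> R) a i :
  open U -> U a -> Ck 1 U f ->
  (\forall t \near (0 : R), f a <= f (t *: delta_mx 0 i + a)) ->
  forall e, 0 < e ->
  \forall t \near (0 : R), `|f (t *: delta_mx 0 i + a) - f a| <= e * `|t|.
Proof.
move=> oU Ua [_ df] fmin e e0; pose phi t := f (t *: delta_mx 0 i + a).
have : \forall t \near (0 : R), U (t *: delta_mx 0 i + a) /\ phi 0 <= phi t.
  apply: filterI; last by rewrite /phi scale0r add0r.
  by have := @line_cvg n a (delta_mx 0 i) U; apply; apply: open_nbhs_nbhs; split.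
move=> /nbhs_ballP[d /= d0 dP].
have inP t : t \in `](- d), d[ -> U (t *: delta_mx 0 i + a) /\ phi 0 <= phi t.
  by rewrite in_itv /= => td; apply: dP; rewrite /ball /= sub0r normrN ltr_norml.
have phi0 : is_derive (0 : R) (1 : R) phi 0.
  apply: (@derive1_at_min R phi (- d) d) => [|t /inP[Ut _]||t /inP[]//].
  - by rewrite (@le_trans _ _ 0) ?oppr_le0 ?ltW.
  - by have [/(_ _ Ut)/is_derive_line[]] := df i.
  - by rewrite in_itv /= oppr_lt0 d0.
have [dphi phiE] := phi0.
have phi_lim : h^-1 *: ((phi \o shift 0) (h *: (1 : R^o)) - phi 0) @[h --> 0^'] -->
    'D_(1 : R^o) phi 0 by exact: dphi.
rewrite phiE in phi_lim.
have /nbhs_ballP[r /= r0 rP] : nbhs (0 : R) (fun t => t != 0 ->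
    `|t^-1 *: ((phi \o shift 0) (t *: (1 : R^o)) - phi 0)| < e).
  exact: (cvgr0_norm_lt _ phi_lim _ e0).
apply/nbhs_ballP; exists r => // t /rP Ht; have [->|t0] := eqVneq t 0.
  by rewrite scale0r add0r subrr !normr0 mulr0.
have /ltW := Ht t0; rewrite /= addr0 [t *: _]mulr1 /phi scale0r add0r.
by rewrite normrZ normfV ler_pdivrMl ?normr_gt0 // mulrC.
Qed.

(** A diffeomorphism onto a neighbourhood of [xi0] in the orthant cannot send a
corner to a point with a positive coordinate: along that coordinate [xi0] has
neighbours on both sides, so the inverse has zero derivative in that direction, as
each of its coordinates attains its minimum 0; but composed with the
diffeomorphism it has derivative 1. *)
Lemma diffeo_corner n (M : manifold (@orthant R n)) (c : chart R n M) b
    (U : set M) xi0 (eps : R) (phi : M -> 'rV[R]_n) :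
  atlas (smooth_str M) c -> dom c b -> Defs.coord c b = 0 -> U b -> phi b = xi0 ->
  diffeo U (@orthant R n `&` disc xi0 eps) phi -> xi0 = 0.
Proof.
move=> ac cb c0 Ub phib [g [[[phi_hom g_hom] [_ g_cont] phiK gK] sm_phi sm_g]].
have [od [V' oV' [[c_hom _] [c_cont _] cK _]]] := atlas_open ac.
have [Vx0 Dx0] : (@orthant R n `&` disc xi0 eps) xi0 by have := phi_hom _ Ub; rewrite phib.
have gx0 : g xi0 = b by rewrite -phib phiK // inE.
have [U1 [G [oU1 U1x G_C1 GE]]] : exists U1 G,
    smooth_extension (Defs.coord c @` (dom c `&` U)) (phi \o param c) 0 U1 G.
  by apply: sm_phi => //; exists b.
have [U2 [F [oU2 U2x F_C1 FE]]] : exists U2 F, smooth_extension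
    ((@orthant R n `&` disc xi0 eps) `&` g @^-1` dom c) (Defs.coord c \o g) xi0 U2 F.
  by apply: sm_g => //; split => //=; rewrite gx0.
apply/rowP => i; rewrite mxE; apply/eqP; rewrite eq_le Vx0 andbT.
rewrite leNgt; apply/negP => xi_gt0.
pose line t := t *: delta_mx 0 i + xi0.
have near_line A : nbhs xi0 A -> \forall t \near (0 : R), A (line t).
  exact: (@line_cvg n xi0 (delta_mx 0 i) A).
have F0 : F xi0 = 0 by rewrite FE //= gx0 // c0.
have lineV : \forall t \near (0 : R), (@orthant R n `&` disc xi0 eps) (line t).
  apply: filterI; last by apply: near_line; apply: open_nbhs_nbhs; split => //; exact: disc_open.
  apply/nbhs_ballP; exists (xi0 0 i) => //= t; rewrite /ball /= sub0r normrN ltr_norml.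
  move=> /andP[t1 t2] j; rewrite !mxE eqxx /=.
  have [->|_] := eqVneq j i; first by rewrite mulr1; lra.
  by rewrite mulr0 add0r; exact: Vx0.
have line_dom : \forall t \near (0 : R), dom c (g (line t)).
  have /subspace_continuousP/(_ xi0 (conj Vx0 Dx0)) cg0 := g_cont.
  have H : nbhs xi0 (fun y => (@orthant R n `&` disc xi0 eps) y -> dom c (g y)).
    apply: (cg0 (dom c)); change (nbhs (g xi0) (dom c)).
    by rewrite gx0; apply: open_nbhs_nbhs; split.
  by apply: filterS2 lineV (near_line _ H) => t lt; apply.
have lineU2 : \forall t \near (0 : R), U2 (line t).
  by apply: near_line; apply: open_nbhs_nbhs; split.
have Fline : \forall t \near (0 : R), [/\ F (line t) = Defs.coord c (g (line t)),
    (@orthant R n `&` disc xi0 eps) (line t) & dom c (g (line t))].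
  near=> t; have lt : (@orthant R n `&` disc xi0 eps) (line t) by near: t.
  have dt : dom c (g (line t)) by near: t.
  by split => //; apply: FE => //; near: t.
have Fmin j : \forall t \near (0 : R), F xi0 0 j <= F (line t) 0 j.
  apply: filterS Fline => t [-> _ dt]; rewrite F0 mxE.
  by have [_ /(_ j)] := c_hom _ dt.
have Fsmall e j : 0 < e ->
    \forall t \near (0 : R), `|F (line t) 0 j| <= e * `|t|.
  move=> e0; have := C1_min_small oU2 U2x (F_C1 1%N j) (Fmin j) e0.
  by apply: filterS => t; rewrite F0 mxE subr0.
have [L /nbhs_ballP[d /= d0 dL]] := C1_bound oU1 U1x (G_C1 1%N i).
have nU1 : nbhs (0 : 'rV[R]_n) U1 by apply: open_nbhs_nbhs; split.
have [r /= r0 rU1] := (nbhs_ballP _ _).1 nU1.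
pose S := \sum_k `|L k|.
have S0 : 0 <= S by apply: sumr_ge0.
(* with this e, [C1_bound] gives |G (F (line t)) - G 0| < t in the i-th coordinate,
   whereas G (F (line t)) = line t *)
pose e := (S + 1)^-1; have e0 : 0 < e by rewrite invr_gt0; lra.
have Fe : \forall t \near (0 : R), forall j, `|F (line t) 0 j| <= e * `|t|.
  exact: (@filter_forall _ _ (fun j t => `|F (line t) 0 j| <= e * `|t|) _
    (nbhs_filter (0 : R)) (fun j => Fsmall e j e0)).
pose m := Num.min d r.
have m0 : 0 < m by rewrite lt_min d0 r0.
have tsmall : \forall t \near (0 : R), e * `|t| < m.
  apply/nbhs_ballP; exists (m / e); first by rewrite /= divr_gt0.
  by move=> t; rewrite /ball /= sub0r normrN ltr_pdivlMr // mulrC.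
have : \forall t \near (0 : R), [/\ [/\ F (line t) = Defs.coord c (g (line t)),
    (@orthant R n `&` disc xi0 eps) (line t) & dom c (g (line t))],
    (forall j, `|F (line t) 0 j| <= e * `|t|) & e * `|t| < m].
  by near=> t; split; near: t.
move=> /nbhs_ballP[q /= q0 qP].
have [|[FEt Vt dt] Ft et] := qP (q / 2).
  by rewrite /ball /= sub0r normrN ger0_norm; lra.
set t := q / 2 in FEt Vt dt Ft et; have t0 : 0 < t by rewrite /t; lra.
have Fball k : 0 < k -> m <= k -> ball (0 : 'rV[R]_n) k (F (line t)).
  move=> k0 mk; split => // i' j; rewrite ord1 /ball /= mxE sub0r normrN.
  by rewrite (le_lt_trans (Ft j)) // (lt_le_trans et).
have GF : G (F (line t)) = line t.
  rewrite GE; [|by apply/rU1/Fball => //; rewrite /m ge_min lexx orbT|].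
    by rewrite /= FEt cK ?inE // gK // inE.
  rewrite FEt; exists (g (line t)) => //; split => //; exact: g_hom.
have G0 : G 0 = xi0.
  by rewrite GE //=; [rewrite -c0 cK ?inE|exists b].
have := dL _ (Fball d d0 _); rewrite GF G0 /m ge_min lexx => /(_ isT).
rewrite !mxE eqxx /= eqxx mulr1 addrK (ger0_norm (ltW t0)); apply/negP; rewrite -ltNge.
have : \sum_k L k * `|F (line t) 0 k - (0 : 'rV[R]_n) 0 k| <= S * (e * t).
  rewrite /S mulr_suml; apply: ler_sum => k _; rewrite mxE subr0.
  rewrite (@le_trans _ _ (`|L k| * `|F (line t) 0 k|)) //.
    by rewrite ler_wpM2r // ler_norm.
  by rewrite ler_wpM2l // (le_trans (Ft k)) // (ger0_norm (ltW t0)).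
move=> /le_lt_trans; apply; rewrite mulrA gtr_pMl // /e.
by rewrite ltr_pdivrMr ?mul1r; lra.
Unshelve. all: by end_near. Qed.

End Corner.
(** * Torus orbits *)


(** In a local trivialization two frames over the same point differ by a right
translation. *)
Lemma trivialization_transitive n (B : topologicalType) (P : principal_bundle n B)
    (p p' : P) : Defs.proj p = Defs.proj p' -> exists A, p' = ract p A.
Proof.
move=> pp'; have [U [phi [_ Up [[psi [_ _ phiK _]] phi1 phiM]]]] :=
  locally_trivial P (Defs.proj p).
exists ((phi p).2^-1 * (phi p').2)%g.
have Up' : U (Defs.proj p') by rewrite -pp'.
rewrite -[LHS]phiK ?inE // -[RHS]phiK ?inE /= ?proj_ract //; congr psi.
rewrite [LHS]surjective_pairing [RHS]surjective_pairing.
by rewrite !phi1 ?proj_ract // phiM // mulgA mulgV mul1g pp'.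
Qed.

Section ToricGeometry.
Variables (R : realType) (n : nat) (B : manifold_with_corners R n).
Variables (P : principal_bundle n B) (X : closed_manifold R (n * 2)).
Variable T : twisted_toric P X.
Local Notation vec := 'rV[R]_n.

(** The point of [X] with angles [x] over the frame [p]: the composite of [nu] with the
two quotient maps.  Lifting angles to [vec] makes each orbit the image of
a vector space, in which curves can be straightened. *)
Definition tor (p : P) (x : vec) : X :=
  nu T (\pi_(assoc_torus R P) (p, \pi_(torus R n) x)).

Lemma mu_tor p x : mu T (tor p x) = Defs.proj p.
Proof. by rewrite /tor mu_nu assoc_projE. Qed.

Lemma tor_ract p A x :
  tor (ract p A) x = tor p (x *m (map_mx intr (val A))^T).
Proof.
congr (nu T _); apply/assoc_torusP; exists (A^-1)%g => /=.
rewrite -ractM mulgV ract1; split=> //.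
by rewrite -SLZ_torusE -SLZ_torusM mulVg SLZ_torus1.
Qed.

Lemma tor_lattice p x (m : 'rV[int]_n) : tor p (x + map_mx intr m) = tor p x.
Proof.
rewrite /tor (_ : \pi_(torus R n) (x + _) = \pi_(torus R n) x) //.
by symmetry; apply/torusP; exists m; rewrite addrAC subrr add0r.
Qed.

Lemma tor_surj z : exists p x, tor p x = z.
Proof.
have : range (nu T) z by rewrite nu_surjective.
move=> [y _ <-]; elim/quotW: y => -[p th]; elim/quotW: th => x.
by exists p, x.
Qed.

Lemma proj_surj b : exists p : P, Defs.proj p = b.
Proof.
have [z _ <-] : range (mu T) b by rewrite mu_surjective.
by have [p [x <-]] := tor_surj z; exists p; rewrite mu_tor.
Qed.

Lemma tor_cont : continuous (fun w : P * vec => tor w.1 w.2).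
Proof.
have c1 : continuous (fun w : P * vec => (w.1, (\pi_(torus R n) w.2))).
  apply: continuous_pair; first exact: continuous_fst.
  move=> w; apply: (@continuous_comp _ _ _ snd (\pi_(torus R n) : vec -> torus R n)).
    exact: continuous_snd.
  exact: pi_continuous.
have c2 : continuous (fun w => nu T (\pi_(assoc_torus R P) w)).
  by move=> w; apply: continuous_comp; [exact: pi_continuous|exact: nu_continuous].
by move=> w; exact: (continuous_comp (c1 w) (c2 _)).
Qed.

Lemma tor0_eq p p' : Defs.proj p = Defs.proj p' -> tor p 0 = tor p' 0.
Proof.
by move=> /trivialization_transitive[A ->]; rewrite tor_ract mul0mx.
Qed.

(** The zero section of the torus bundle is globally defined because the
structure group acts by linear maps, which fix 0. *)
Definition zsec (b : B) : X := tor (projT1 (boolp.cid (proj_surj b))) 0.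

Lemma zsecE p : tor p 0 = zsec (Defs.proj p).
Proof. by apply: tor0_eq; case: boolp.cid => p' /= ->. Qed.

Lemma mu_zsec b : mu T (zsec b) = b.
Proof. by rewrite /zsec mu_tor; case: boolp.cid. Qed.

(** A toric chart centred at [b], recast as a local section [s] of [P] along
which [tor] becomes polar coordinates. *)
Record toric_chart (b : B) (U : set B) (xi0 : vec) (eps : R)
    (phiX : X -> 'rV[R]_(n * 2)) (gX : 'rV[R]_(n * 2) -> X)
    (phiB : B -> vec) (gB : vec -> B) (s : B -> P) : Prop := {
  tc_open : open U;
  tc_mem : U b;
  tc_phiB : homeo_on U (@orthant R n `&` disc xi0 eps) phiB gB;
  tc_center : phiB b = xi0;
  tc_phiX : homeo_on (mu T @^-1` U) (@mu_C R n @^-1` disc xi0 eps) phiX gX;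
  tc_sec_cont : {within U, continuous s};
  tc_sec : forall b', U b' -> Defs.proj (s b') = b';
  tc_tor : forall b' x, U b' -> phiX (tor (s b') x) = cpolar (phiB b') x;
  tc_mu : forall z, U (mu T z) -> mu_C (phiX z) = phiB (mu T z) }.

(** The smoothness of the base chart is recorded because it identifies the corners. *)
Lemma toric_chart_ex b : exists U xi0 eps phiX gX phiB gB s,
  toric_chart b U xi0 eps phiX gX phiB gB s /\ diffeo U (@orthant R n `&` disc xi0 eps) phiB.
Proof.
have [U [xi0 [eps [phiP [phiX [phiB C]]]]]] := locally_toric T b.
have [gB [hB _ _]] := ltc_phiB C; have [gX [hX _ _]] := ltc_phiX C.
have lP := ltc_phiP C; have [[psi [[phi_hom psi_hom] [_ psi_cont] _ psiK]] phi1 _] := lP.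
have psiU b' : U b' -> phiP (psi (b', 1%g)) = (b', 1%g).
  by move=> Ub'; apply: psiK; rewrite inE; split.
have sec b' : U b' -> Defs.proj (psi (b', 1%g)) = b'.
  by move=> Ub'; rewrite -phi1 ?psiU //; exact: (psi_hom (b', 1%g)).
exists U, xi0, eps, phiX, gX, phiB, gB, (fun b' => psi (b', 1%g)).
split; last exact: (ltc_phiB C).
split => //; try by case: C.
- apply: (@Defs.within_continuous_comp _ _ _ _ (U `*` [set: SLZ n]) psi
    (fun b' => (b', 1%g))) => //.
  apply: continuous_subspaceT; apply: continuous_pair => z; first exact: cvg_id.
  exact: cvg_cst.
- move=> b' x Ub'.
  have Uy : U (assoc_proj (\pi_(assoc_torus R P) (psi (b', 1%g), \pi_(torus R n) x))).
    by rewrite assoc_projE /= sec.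
  rewrite /tor (ltc_nu C Uy) (assoc_trivializationE lP) /= ?sec //.
  by rewrite psiU // SLZ_torus1.
Qed.

Section Chart.
Variables (b : B) (U : set B) (xi0 : vec) (eps : R).
Variables (phiX : X -> 'rV[R]_(n * 2)) (gX : 'rV[R]_(n * 2) -> X).
Variables (phiB : B -> vec) (gB : vec -> B) (s : B -> P).
Hypothesis C : toric_chart b U xi0 eps phiX gX phiB gB s.

Lemma tc_phiX_inj z z' : U (mu T z) -> U (mu T z') -> phiX z = phiX z' -> z = z'.
Proof.
move=> Uz Uz' E; have [_ _ K _] := tc_phiX C.
by rewrite -(K z) ?inE // E K ?inE.
Qed.

Lemma tc_orthant b' : U b' -> orthant (phiB b').
Proof. by move=> Ub'; have [[h _] _ _ _] := tc_phiB C; have [] := h _ Ub'. Qed.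

Lemma tc_act p : U (Defs.proj p) -> exists A : SLZ n,
  forall y, tor p y = tor (s (Defs.proj p)) (y *m (map_mx intr (val A))^T).
Proof.
move=> Up; have [A ->] := trivialization_transitive (tc_sec C Up).
by exists A => y; rewrite proj_ract tor_ract (tc_sec C).
Qed.

End Chart.

(** * Curves in a torus orbit *)

Lemma seg_cont (x y : vec) : {within I01 R, continuous (fun t => x + t *: (y - x))}.
Proof. by apply: continuous_subspaceT; apply: affine_rV_continuous => t; exact: cvg_id. Qed.

Lemma tor_fiber_cont p : continuous (tor p).
Proof.
have c1 : continuous (fun x : vec => (p, x)).
  apply: (@Defs.continuous_pair _ _ _ (fun=> p) id) => x; last exact: cvg_id.
  exact: cst_continuous.
by move=> x; exact: (continuous_comp (c1 x) (@tor_cont _)).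
Qed.

Lemma tseg_cont p x y : {within I01 R, continuous (fun t => tor p (x + t *: (y - x)))}.
Proof.
apply: (@Defs.within_continuous_comp R vec X _ setT (tor p)
  (fun t => x + t *: (y - x))) => //; last exact: seg_cont.
by apply: continuous_subspaceT; exact: tor_fiber_cont.
Qed.

Lemma tseg0 p x y a : tor p x = a -> tor p (x + 0 *: (y - x)) = a.
Proof. by rewrite scale0r addr0. Qed.

Lemma tseg1 p x y a : tor p y = a -> tor p (x + 1 *: (y - x)) = a.
Proof. by rewrite scale1r addrC subrK. Qed.

Definition tseg p x y a b (ea : tor p x = a) (eb : tor p y = b) : curve R a b :=
  Curve (@tseg_cont p x y) (tseg0 y ea) (tseg1 x eb).

Lemma tseg_comp p x y z a b c (ea : tor p x = a) (eb : tor p y = b) (ec : tor p z = c) :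
  cls (tseg ea eb) \;; cls (tseg eb ec) = cls (tseg ea ec).
Proof.
apply: (@convex_cls_comp R vec X setT (tor p) _ _ _ _ _ _ _ _
  (fun t => x + t *: (y - x)) (fun t => y + t *: (z - y)) (fun t => x + t *: (z - x))) => //.
- by apply: continuous_subspaceT; exact: tor_fiber_cont.
- exact: seg_cont.
- exact: seg_cont.
- exact: seg_cont.
- by rewrite !scale0r.
- by rewrite scale1r scale0r addr0 addrC subrK.
- by rewrite !scale1r addrC subrK addrC subrK.
Qed.

Lemma tseg_act p p' A x y a b (ea : tor p x = a) (eb : tor p y = b)
    (ea' : tor p' (x *m A) = a) (eb' : tor p' (y *m A) = b) :
  (forall w, tor p w = tor p' (w *m A)) -> cls (tseg ea eb) = cls (tseg ea' eb').
Proof.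
move=> pp'; apply: cls_eq => t _ /=.
by rewrite pp' mulmxDl -scalemxAl mulmxBl.
Qed.

(** The closed curves in integer directions generate the fundamental group of the torus,
so the whole orbit is required to contract at the level of curves. *)
Definition contractible_orbit (p : P) := forall x (m : 'rV[int]_n) a
  (e : tor p x = a) (e' : tor p (x + map_mx intr m) = a), cls (tseg e e') = hid R a.

(** The structure group preserves the integer lattice. *)
Lemma contractible_orbit_ract p A :
  contractible_orbit p -> contractible_orbit (ract p A).
Proof.
move=> cp x m a e e'; pose M : 'M[R]_n := (map_mx intr (val A))^T.
have pp w : tor (ract p A) w = tor p (w *m M) by exact: tor_ract.
have ea : tor p (x *m M) = a by rewrite -pp.
have E : (x + map_mx intr m) *m M = x *m M + map_mx intr (m *m (val A)^T).
  by rewrite mulmxDl /M map_trmx map_mxM.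
have eb0 : tor p ((x + map_mx intr m) *m M) = a by rewrite -pp.
rewrite (tseg_act e e' ea eb0 pp); move: eb0; rewrite E => eb0.
exact: cp.
Qed.

Definition contractible_fiber (b : B) :=
  forall p, Defs.proj p = b -> contractible_orbit p.

Lemma contractible_fiber1 p : contractible_orbit p -> contractible_fiber (Defs.proj p).
Proof.
move=> cp p' /esym/trivialization_transitive[A ->].
exact: contractible_orbit_ract.
Qed.

(** All polar radii vanish at the centre of a chart centred at 0, so [tor] is constant on
the fibre. *)
Lemma contractible_corner b U eps phiX gX phiB gB s :
  toric_chart b U 0 eps phiX gX phiB gB s -> contractible_fiber b.
Proof.
move=> C; have Ub := tc_mem C; rewrite -(tc_sec C Ub).
apply: contractible_fiber1 => x m a e e'; apply: cls_eq => t _ /=.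
rewrite -e; apply: (tc_phiX_inj C); rewrite ?mu_tor ?(tc_sec C) //.
rewrite !(tc_tor C) // (tc_center C); apply: coords_inj => i.
by rewrite !coords_cpolar mxE !polar0.
Qed.

(** Moving a closed orbit curve along a path of frames is a free homotopy, and a curve
freely homotopic to a contractible one is contractible.  Both vertical sides of
the square are the track [l] of the base point. *)
Lemma contractible_transport (c : R -> P) : {within I01 R, continuous c} ->
  contractible_orbit (c 1) -> contractible_orbit (c 0).
Proof.
move=> cc c1 x m a e e'.
pose K (z : R * R) := tor (c z.1) (x + z.2 *: map_mx intr m).
have cK : {within I2 R, continuous K}.
  apply: (@Defs.within_continuous_comp _ (P * vec)%type X _ setT (fun w => tor w.1 w.2)
    (fun z : R * R => (c z.1, x + z.2 *: map_mx intr m))) => //.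
    by apply: continuous_subspaceT; exact: tor_cont.
  apply: within_continuous_pair.
    apply: (@Defs.within_continuous_comp _ _ _ _ (I01 R) c fst) => //.
      by apply: continuous_subspaceT; exact: continuous_fst.
    by move=> [? ?] [].
  by apply: continuous_subspaceT; apply: affine_rV_continuous; exact: continuous_snd.
have K1 s : K (s, 1) = K (s, 0) by rewrite /K /= scale1r scale0r addr0 tor_lattice.
have cl : {within I01 R, continuous (fun s => K (s, 0))}.
  apply: (@Defs.within_continuous_comp _ _ _ _ (I2 R) K (fun s => (s, 0))) => //.
    by apply: continuous_subspaceT; continuity.
  by move=> s s01; split => //; exact: I010.
have l0 : K (0, 0) = a by rewrite /K /= scale0r addr0.
have f1 : tor (c 1) x = K (1, 0) by rewrite /K /= scale0r addr0.
have f1' : tor (c 1) (x + map_mx intr m) = K (1, 0) by rewrite tor_lattice.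
pose l : curve R a (K (1, 0)) := Curve cl l0 erefl.
have := @square_cls R X K cK _ _ _ _ (tseg e e') (tseg f1 f1') l l.
rewrite c1 hcompg1 => H.
apply: (@hcomp_inj _ _ _ _ _ _ _ (cls l)); rewrite hcomp1g; apply: H => //.
- by move=> t _; rewrite /K /= addrAC subrr add0r.
- by move=> t _; rewrite /K /= addrAC subrr add0r.
Qed.

(** The segment in the chart between the images of two nearby points lifts to [P] through the
local section. *)
Lemma contractible_local b : \forall b' \near b,
  (contractible_fiber b' -> contractible_fiber b) /\
  (contractible_fiber b -> contractible_fiber b').
Proof.
have [U [xi0 [eps [phiX [gX [phiB [gB [s [C _]]]]]]]]] := toric_chart_ex b.
have Ub := tc_mem C.
have [[phi_hom g_hom] [phi_cont g_cont] phiK _] := tc_phiB C.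
have nU : nbhs b U by rewrite nbhsE; exists U => //; split => //; exact: tc_open C.
have : nbhs (phiB b) (disc xi0 eps).
  by have [_ ?] := phi_hom _ Ub; rewrite nbhsE; exists (disc xi0 eps) => //;
    split => //; exact: disc_open.
move=> /nbhs_ballP[r /= r0 rD].
have phi_near : \forall b' \near b, ball (phiB b) r (phiB b').
  have phi_at : {for b, continuous phiB}.
    by move: phi_cont; rewrite (continuous_open_subspace _ (tc_open C)); apply; rewrite inE.
  by apply: phi_at; exact: nbhsx_ballx.
near=> b'.
have Ub' : U b' by near: b'.
have rb' : ball (phiB b) r (phiB b') by near: b'.
pose xi t := phiB b + t *: (phiB b' - phiB b).
have xiV t : I01 R t -> (@orthant R n `&` disc xi0 eps) (xi t).
  move=> t01; split; last by apply/rD/ball_convex => //; exact: ballxx.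
  move=> i; rewrite !mxE; have := tc_orthant C Ub i; have := tc_orthant C Ub' i.
  by move/in01: t01 => /andP[? ?]; nra.
have cc : {within I01 R, continuous (fun t => s (gB (xi t)))}.
  apply: (@Defs.within_continuous_comp _ _ _ _ U s (gB \o xi)) => //; first exact: tc_sec_cont C.
    apply: (@Defs.within_continuous_comp R vec B _ (@orthant R n `&` disc xi0 eps) gB xi) => //.
    exact: seg_cont.
  by move=> t t01; exact/g_hom/xiV.
have E0 : s (gB (xi 0)) = s b by rewrite /xi scale0r addr0 phiK // inE.
have E1 : s (gB (xi 1)) = s b' by rewrite /xi scale1r addrC subrK phiK // inE.
split => H.
- rewrite -(tc_sec C Ub); apply: contractible_fiber1; rewrite -E0.
  apply: (@contractible_transport (fun t => s (gB (xi t)))) => //.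
  by rewrite E1; apply: H; exact: tc_sec C _ Ub'.
- rewrite -(tc_sec C Ub'); apply: contractible_fiber1; rewrite -E1.
  have -> : s (gB (xi 1)) = (fun t => s (gB (xi (1 - t)))) 0 by rewrite /= subr0.
  apply: (@contractible_transport (fun t => s (gB (xi (1 - t))))).
    apply: (@Defs.within_continuous_comp R R P _ (I01 R)
      (fun t => s (gB (xi t))) (fun t => 1 - t)) => //.
      by apply: continuous_subspaceT; continuity.
    by move=> t /in01 ?; apply/in01; lra.
  by rewrite /= subrr E0; apply: H; exact: tc_sec C _ Ub.
Unshelve. all: by end_near. Qed.

Lemma contractible_all b0 : contractible_fiber b0 -> forall b, contractible_fiber b.
Proof.
move=> H0 b.
apply: (@connected_chain B setT (fun b b' => contractible_fiber b -> contractible_fiber b')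
  _ _ _ b0 b) => //.
- exact: manifold_connected.
- by move=> x y z _ _ _ xy yz /xy/yz.
- by move=> x _; have := contractible_local x; apply: filterS => y [? ?] _; split.
Qed.

End ToricGeometry.
(** * The retraction onto the zero section *)

Section Retraction.
Variables (R : realType) (n : nat) (B : manifold_with_corners R n).
Variables (P : principal_bundle n B) (X : closed_manifold R (n * 2)).
Variable T : twisted_toric P X.
Local Notation vec := 'rV[R]_n.
Local Notation tor := (tor T).
Local Notation zsec := (zsec T).

Lemma zsec_cont : continuous zsec.
Proof.
move=> b; have [U [xi0 [eps [phiX [gX [phiB [gB [s [C _]]]]]]]]] := toric_chart_ex T b.
have : {within U, continuous zsec}.
  apply: (@within_continuous_eq _ _ _ (fun b' => tor (s b') 0)).
    by move=> b' Ub'; rewrite zsecE (tc_sec C).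
  apply: (@Defs.within_continuous_comp B (P * vec)%type X _ setT (fun w => tor w.1 w.2)
    (fun b' => (s b', 0))) => //.
    by apply: continuous_subspaceT; exact: tor_cont.
  apply: within_continuous_pair; first exact: tc_sec_cont C.
  by apply: continuous_subspaceT; exact: cst_continuous.
rewrite (continuous_open_subspace _ (tc_open C)); apply; rewrite inE.
exact: tc_mem C.
Qed.

Hypothesis fibers_contract : forall b, contractible_fiber T b.

(** Two angle vectors of the same point differ by integers in the coordinates that do
not vanish, while the others do not matter, even after rescaling; so
[x + m] may replace [x']. *)
Lemma radial_unique_chart b U xi0 eps phiX gX phiB gB s b' x x' a c
    (e : tor (s b') x = a) (e' : tor (s b') x' = a) (e0 : tor (s b') 0 = c) :
  toric_chart T b U xi0 eps phiX gX phiB gB s -> U b' ->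
  cls (tseg e e0) = cls (tseg e' e0).
Proof.
move=> C Ub'; have E : cpolar (phiB b') x = cpolar (phiB b') x'.
  by rewrite -!(tc_tor C) // e e'.
have xi_ge0 := tc_orthant C Ub'.
have /boolp.choice[g gP] : forall i, exists k : int,
    0 < phiB b' 0 i -> x' 0 i - x 0 i = k%:~R.
  move=> i; case: (ltP 0 (phiB b' 0 i)) => [xi_gt0|_]; last by exists 0.
  have /(congr1 (fun z => coords z i)) := E; rewrite !coords_cpolar.
  by move=> /(polar_eq xi_gt0)[k kE]; exists k.
pose m : 'rV[int]_n := \row_i g i.
have ey : tor (s b') (x + map_mx intr m) = a by rewrite tor_lattice.
rewrite -(tseg_comp e ey e0) (fibers_contract (tc_sec C Ub')) hcomp1g.
apply: cls_eq => t _ /=; apply: (tc_phiX_inj C); rewrite ?mu_tor ?(tc_sec C) //.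
rewrite !(tc_tor C) //; apply: coords_inj => i; rewrite !coords_cpolar !mxE.
have := xi_ge0 i; rewrite le_eqVlt => /predU1P[<-|/gP xg]; first by rewrite !polar0.
by rewrite -xg; congr (polar _ _); ring.
Qed.

(** Both frames are first exchanged for the frame of a toric chart. *)
Lemma radial_unique p x p' x' a c (e : tor p x = a) (e' : tor p' x' = a)
    (e0 : tor p 0 = c) (e0' : tor p' 0 = c) :
  cls (tseg e e0) = cls (tseg e' e0').
Proof.
have pp' : Defs.proj p' = Defs.proj p by rewrite -(mu_tor T p x) e -e' mu_tor.
have [U [xi0 [eps [phiX [gX [phiB [gB [s [C _]]]]]]]]] :=
  toric_chart_ex T (Defs.proj p).
have Up := tc_mem C.
have [A pA] := tc_act C Up.
have [A' pA'] : exists A' : SLZ n, forall y,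
    tor p' y = tor (s (Defs.proj p)) (y *m (map_mx intr (val A'))^T).
  by rewrite -pp'; apply: (tc_act C); rewrite pp'.
have ea := e; rewrite pA in ea; have ea' := e'; rewrite pA' in ea'.
have eb := e0; rewrite pA in eb; have eb' := e0'; rewrite pA' in eb'.
rewrite (tseg_act e e0 ea eb pA) (tseg_act e' e0' ea' eb' pA').
move: eb eb'; rewrite !mul0mx => eb eb'.
by rewrite (Prop_irrelevance eb' eb); exact: (radial_unique_chart _ _ _ C).
Qed.

Lemma radial_end p x a : tor p x = a -> tor p 0 = zsec (mu T a).
Proof. by move=> <-; rewrite zsecE mu_tor. Qed.

Definition radial (a : X) : hom R a (zsec (mu T a)) :=
  let: exist p H := boolp.cid (tor_surj T a) in
  let: exist x e := boolp.cid H in cls (tseg e (radial_end e)).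

Lemma radialE p x a (e : tor p x = a) : radial a = cls (tseg e (radial_end e)).
Proof.
by rewrite /radial; case: boolp.cid => p' H; case: boolp.cid => x' e';
  exact: radial_unique.
Qed.

Lemma zmu_cont : continuous (zsec \o mu T).
Proof.
by move=> z; apply: continuous_comp; [exact: mu_continuous|exact: zsec_cont].
Qed.

Section Naturality.
Variables (f : R -> X).
Hypothesis cf : {within I01 R, continuous f}.

Lemma zmu_sub_cont : {within I01 R, continuous (zsec \o mu T \o f)}.
Proof.
apply: (@Defs.within_continuous_comp R X X _ setT) => //.
by apply: continuous_subspaceT; exact: zmu_cont.
Qed.

Definition natural_on s t := forall (hs : I01 R s) (ht : I01 R t),
  cls (subcurve cf hs ht) \;; radial (f t) =
  radial (f s) \;; cls (subcurve zmu_sub_cont hs ht).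

Lemma natural_trans s t u : I01 R t ->
  natural_on s t -> natural_on t u -> natural_on s u.
Proof.
move=> ht st tu hs hu.
rewrite -(@sub_cls R X f cf s t u _ _ _ (subcurve cf hs ht) (subcurve cf ht hu)) //.
rewrite -(@sub_cls R X _ zmu_sub_cont s t u _ _ _
  (subcurve zmu_sub_cont hs ht) (subcurve zmu_sub_cont ht hu)) //.
by rewrite -hcompA tu hcompA st -hcompA.
Qed.

(** Near [f t0] the curve is homotopic, inside a ball of the chart, to a curve
which is linear in polar coordinates; for the latter the angles shrink to 0
continuously, which gives a commuting square. *)
Lemma natural_local t0 : I01 R t0 -> exists2 d : R, 0 < d &
  forall s t, ball t0 d s -> ball t0 d t -> natural_on s t.
Proof.
move=> t0_01; set b0 := mu T (f t0).
have [U [xi0 [eps [phiX [gX [phiB [gB [sec [C _]]]]]]]]] := toric_chart_ex T b0.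
have Ub0 := tc_mem C.
have [[homB homgB] [_ gB_cont] phiBK gBK] := tc_phiB C.
have [[homX homgX] [phiX_cont gX_cont] phiXK gXK] := tc_phiX C.
have repr_sec z : U (mu T z) -> exists x, tor (sec (mu T z)) x = z.
  move=> Uz; have [p [x px]] := tor_surj T z.
  have pz : Defs.proj p = mu T z by rewrite -px mu_tor.
  have Up : U (Defs.proj p) by rewrite pz.
  have [A pA] := tc_act C Up.
  by exists (x *m (map_mx intr (val A))^T); rewrite -pz -pA px.
have [x0 x0E] := repr_sec _ Ub0.
have z0E : phiX (f t0) = cpolar (phiB b0) x0 by rewrite -(tc_tor C) // x0E.
set W := _ @^-1` _ in gX_cont homX homgX gXK.
have Wopen : open W.
  by apply: open_comp; [move=> ? _; exact: mu_C_cont|exact: disc_open].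
have : nbhs (phiX (f t0)) W.
  by rewrite nbhsE; exists W => //; split=> //; exact: homX.
move=> /nbhs_ballP[r /= r0 rW].
have Nr : nbhs (cpolar (phiB b0) x0) (ball (phiX (f t0)) r).
  by rewrite -z0E; exact: nbhsx_ballx.
have [K [Kconv KN Knear]] := cpolar_local (tc_orthant C Ub0) Nr.
(* the points to which polar coordinates in K can be assigned *)
pose G z := [/\ U (mu T z), ball (phiX (f t0)) r (phiX z) &
  exists2 x : vec, K (phiB (mu T z), x) & tor (sec (mu T z)) x = z].
have Gnear : \forall z \near f t0, G z.
  have muU : nbhs (f t0) (mu T @^-1` U).
    apply: mu_continuous; rewrite nbhsE; exists U => //; split => //.
    exact: tc_open C.
  have oU : open (mu T @^-1` U).
    by apply: open_comp; [move=> ? _; exact: mu_continuous|exact: tc_open C].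
  have phi_at : {for f t0, continuous phiX}.
    by move: phiX_cont; rewrite (continuous_open_subspace _ oU); apply; rewrite inE.
  rewrite -z0E in Knear; have {}Knear := phi_at _ Knear.
  have rnear := phi_at _ (nbhsx_ballx _ _ r0).
  near=> z; have Uz : U (mu T z) by near: z.
  split => //; first by near: z.
  have [x xz] := repr_sec _ Uz.
  have mz : mu_C (phiX z) = phiB (mu T z) by exact: tc_mu C _ Uz.
  have [x' Kx' zx'] : exists2 x', K (mu_C (phiX z), x') &
      phiX z = cpolar (mu_C (phiX z)) x'.
    suff H : forall x, phiX z = cpolar (mu_C (phiX z)) x ->
      exists2 x', K (mu_C (phiX z), x') & phiX z = cpolar (mu_C (phiX z)) x'.
      by apply: (H x); rewrite mz -(tc_tor C) // xz.
    by near: z.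
  rewrite mz in Kx' zx'; exists x' => //.
  apply: (tc_phiX_inj C) => //; first by rewrite mu_tor (tc_sec C).
  by rewrite (tc_tor C).
have /subspace_continuousP/(_ _ t0_01) cf0 := cf.
have : nbhs t0 (fun t => I01 R t -> G (f t)) by exact: cf0 _ Gnear.
move=> /nbhs_ballP[d /= d0 dG]; exists d => // s t ds dt hs ht.
have Gu u : I01 R u -> G (sub_fun f s t u).
  move=> u01; apply: dG; last exact: (@I01_convex R s t u).
  exact: (@ball_convex R^o).
have [Us rs [xs Ks xsE]] : G (f s) by exact: dG.
have [Ut rt [xt Kt xtE]] : G (f t) by exact: dG.
pose ws := (phiB (mu T (f s)), xs); pose wt := (phiB (mu T (f t)), xt).
(* w is the curve of polar coordinates, q its image in C^n, and gX \o q in X *)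
pose w u : vec * vec := ws + u *: (wt - ws).
have w0 : w 0 = ws by rewrite /w scale0r addr0.
have w1 : w 1 = wt by rewrite /w scale1r addrC subrK.
have Kw u : I01 R u -> K (w u) by move=> u01; exact: Kconv.
have cw : continuous w.
  have cw1 : continuous (fun u => (w u).1).
    by apply: (@affine_rV_continuous R n R id) => ?; exact: cvg_id.
  have cw2 : continuous (fun u => (w u).2).
    by apply: (@affine_rV_continuous R n R id) => ?; exact: cvg_id.
  by have := Defs.continuous_pair cw1 cw2; rewrite (_ : (fun _ => _) = w) //;
    apply: boolp.funext => u; rewrite [RHS]surjective_pairing.
pose q u := cpolar (w u).1 (w u).2.
have qr u : I01 R u -> ball (phiX (f t0)) r (q u) by move=> /Kw/KN[].
have cq : {within I01 R, continuous q}.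
  apply: continuous_subspaceT => u; exact: (continuous_comp (cw u) (@cpolar_cont R n _)).
have muq u : I01 R u -> mu_C (q u) = (w u).1.
  by move=> /Kw/KN[? _]; exact: mu_C_cpolar.
have wV u : I01 R u -> (@orthant R n `&` disc xi0 eps) (w u).1.
  move=> u01; split; first by have [] := KN _ (Kw _ u01).
  by rewrite -muq //; exact/rW/qr.
have Uw u : I01 R u -> U (gB (w u).1) by move=> /wV/homgB.
have gXq u : I01 R u -> gX (q u) = tor (sec (gB (w u).1)) (w u).2.
  move=> u01; apply: (tc_phiX_inj C).
  - by apply: homgX; exact/rW/qr.
  - by rewrite mu_tor (tc_sec C) //; exact: Uw.
  - by rewrite gXK ?inE; [rewrite (tc_tor C) ?gBK ?inE //; [exact: wV|exact: Uw]|exact/rW/qr].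
have ce : {within I01 R, continuous (gX \o q)}.
  by apply: (@Defs.within_continuous_comp R _ X _ W) => // u /qr/rW.
have gBs : gB (w 0).1 = mu T (f s) by rewrite w0 phiBK // inE.
have gBt : gB (w 1).1 = mu T (f t) by rewrite w1 phiBK // inE.
have e0 : (gX \o q) 0 = f s by rewrite /= gXq ?gBs ?w0 //; exact: I010.
have e1 : (gX \o q) 1 = f t by rewrite /= gXq ?gBt ?w1 //; exact: I011.
pose e : curve R (f s) (f t) := Curve ce e0 e1.
have fe : cls (subcurve cf hs ht) = cls e.
  apply: (@convex_cls_eq R _ X (ball (phiX (f t0)) r) gX _ _ _ _ _ _
    (phiX \o sub_fun f s t) q) => //.
  - by move=> a b v; exact: ball_convex.
  - by apply: (continuous_subspaceW rW); exact: gX_cont.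
  - apply: (@Defs.within_continuous_comp R X _ _ (mu T @^-1` U)) => //.
      exact: sub_cont.
    by move=> u /Gu[].
  - by move=> u /Gu[].
  - by rewrite /= sub_fun0 -e0 /= gXK // inE; exact/rW/qr/I010.
  - by rewrite /= sub_fun1 -e1 /= gXK // inE; exact/rW/qr/I011.
  - by move=> u /Gu[Uu _ _] /=; rewrite phiXK // inE.
have zf : cls (subcurve zmu_sub_cont hs ht) = cls (cmap zmu_cont erefl erefl e).
  transitivity (cls (cmap zmu_cont erefl erefl (subcurve cf hs ht))).
    exact: cls_eq.
  exact: cmap_cls.
rewrite fe zf (radialE xsE) (radialE xtE).
(* the first coordinate of the square scales the angles down to 0 *)
pose H (z : R * R) := tor (sec (gB (w z.2).1)) ((w z.2).2 + z.1 *: (0 - (w z.2).2)).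
have cH : {within I2 R, continuous H}.
  apply: (@Defs.within_continuous_comp _ (P * vec)%type X _ setT (fun w => tor w.1 w.2)
    (fun z : R * R => (sec (gB (w z.2).1), (w z.2).2 + z.1 *: (0 - (w z.2).2)))) => //.
    by apply: continuous_subspaceT; exact: tor_cont.
  apply: within_continuous_pair.
    apply: (@Defs.within_continuous_comp _ B P _ U sec (fun z : R * R => gB (w z.2).1)).
    - exact: tc_sec_cont C.
    - apply: (@Defs.within_continuous_comp _ vec B _ (@orthant R n `&` disc xi0 eps)
        gB (fun z : R * R => (w z.2).1)) => //; last by move=> z [_ /wV].
      apply: continuous_subspaceT => z.
      by apply: (@continuous_comp _ _ _ snd (fun u => (w u).1));
        [exact: continuous_snd|exact: (continuous_comp (cw _) (@continuous_fst _ _ _))].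
    - by move=> z [_ /Uw].
  apply: continuous_subspaceT; apply: rV_continuous => j.
  have cwj : continuous (fun z : R * R => (w z.2).2 ord0 j).
    have c2 : continuous (fun u => (w u).2 ord0 j).
      move=> u; exact: (continuous_comp (continuous_comp (cw u) (@continuous_snd _ _ _))
        (@coord_continuous _ _ _ _ _ _)).
    by move=> z; exact: (continuous_comp (@continuous_snd _ _ z) (c2 _)).
  rewrite (_ : (fun _ => _) = fun z : R * R =>
    (w z.2).2 ord0 j + z.1 * (0 - (w z.2).2 ord0 j)); last first.
    by apply: boolp.funext => z; rewrite !mxE.
  apply: continuous_addr => //; apply: continuous_mulr; first exact: continuous_fst.
  by apply: continuous_subr => //; exact: cst_continuous.
have HE a c : H (a, c) = tor (sec (gB (w c).1)) ((w c).2 + a *: (0 - (w c).2)).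
  by [].
apply: (@square_cls R X H cH) => u u01; rewrite HE.
- by rewrite scale0r addr0 -gXq.
- by rewrite scale1r sub0r subrr zsecE -(mu_tor T _ (w u).2) -gXq.
- by rewrite gBs w0.
- by rewrite gBt w1.
Unshelve. all: by end_near. Qed.

Lemma natural_all s t : I01 R s -> I01 R t -> natural_on s t.
Proof.
apply: (@connected_chain R (I01 R) natural_on (@segment_connected R 0 1)).
  by move=> x y z _ y01 _; exact: natural_trans.
move=> x x01; have [d d0 dP] := natural_local x01.
near=> y => _; have yd : ball x d y by near: y; exact: nbhsx_ballx.
by split; apply: dP => //; exact: ballxx.
Unshelve. all: by end_near. Qed.

End Naturality.

(** Every curve of [X] is thus homotopic, up to the radial paths at its endpoints, to its
projection to the zero section. *)
Lemma radial_natural x y (g : curve R x y) :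
  cls g \;; radial y = radial x \;; cls (cmap zmu_cont erefl erefl g).
Proof.
case: g => f cf f0 f1; case: _ / f0; case: _ / f1.
have sub01E (S : topologicalType) (h : R -> S) v : h v = sub_fun h 0 1 v.
  by rewrite /sub_fun add0r subr0 mulr1.
rewrite (_ : cls (Curve cf erefl erefl) = cls (subcurve cf (@I010 R) (@I011 R))).
  rewrite natural_all; [|exact: I010|exact: I011].
  by congr (_ \;; _); apply: cls_eq => t _; rewrite /= -sub01E.
by apply: cls_eq => t _; rewrite /= -sub01E.
Qed.

End Retraction.
(** * The induced map on fundamental groups *)

Section Loops.
Variables (R : realType) (T : topologicalType) (x : T).

Definition loop_curve (l : loop R x) : curve R x x :=
  Curve (@loop_cont R T x l) (loop0 l) (loop1 l).

Definition curve_loop (g : curve R x x) : loop R x :=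
  Loop (@curve_cont R T x x g) (curve0 g) (curve1 g).

Lemma pi1_cls (l l' : loop R x) :
  \pi_(pi1 R x) l = \pi_(pi1 R x) l' <-> cls (loop_curve l) = cls (loop_curve l').
Proof.
split => [/pi1P lH|/clsP lH]; first exact/clsP.
exact/pi1P.
Qed.

End Loops.

Section InducedMap.
Variables (R : realType) (S T : topologicalType) (f : S -> T) (x : S) (y : T).
Hypotheses (fc : continuous f) (fx : f x = y).

Lemma pi1_mapM : {morph (pi1_map (R := R) fc fx) : a b / (a * b)%g}.
Proof.
elim/quotW=> l; elim/quotW=> l'.
have mE (U : topologicalType) (z : U) (g h : loop R z) :
    ((\pi_(pi1 R z) g : pi1 R z) * \pi_(pi1 R z) h)%g = \pi_(pi1 R z) (concat g h).
  exact: pi1_mulE.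
rewrite mE !pi1_mapE mE; apply/pi1_cls/cls_eq => t _ /=.
by rewrite /concat_fun /=; case: ifP.
Qed.

End InducedMap.

Section Main.
Variables (R : realType) (n : nat) (B : manifold_with_corners R n).
Variables (P : principal_bundle n B) (X : closed_manifold R (n * 2)).
Variable T : twisted_toric P X.
Hypothesis fibers_contract : forall b, contractible_fiber T b.
Variables (x0 : X) (b : B) (hb : mu T x0 = b).

Local Notation muc := (@mu_continuous _ _ _ _ _ T).

Lemma pi1_mu_inj : injective (pi1_map (R := R) muc hb).
Proof.
case: _ / hb; elim/quotW=> l; elim/quotW=> l'.
rewrite !pi1_mapE => /pi1_cls E; apply/pi1_cls.
apply: (@hcomp_inj _ _ _ _ _ _ _ (radial T x0)).
rewrite !(radial_natural fibers_contract); congr (_ \;; _).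
have := cmap_cls (@zsec_cont _ _ _ _ _ T) erefl erefl E.
by move=> E'; etransitivity; [|etransitivity; [exact: E'|]]; exact: cls_eq.
Qed.

(** The lift of [g] is its image under [zsec], transported to the base point by the radial
class; naturality recovers [zsec \o g] from it. *)
Lemma pi1_mu_surj a : exists c, pi1_map (R := R) muc hb c = a.
Proof.
case: _ / hb a; elim/quotW=> g.
pose zg := cmap (@zsec_cont _ _ _ _ _ T) erefl erefl (loop_curve g).
pose c := radial T x0 \;; cls zg \;; hinv (radial T x0).
exists (\pi_(pi1 R x0) (curve_loop (repr c))); rewrite pi1_mapE; apply/pi1_cls.
have cE : cls (repr c) = c by exact: reprK.
have := radial_natural fibers_contract (repr c).
rewrite cE /c -hcompA hcompVg hcompg1 => /hcomp_injl E.
have := cmap_cls muc (mu_zsec T _) (mu_zsec T _) E.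
move=> E'; etransitivity; [|etransitivity; [symmetry; exact: E'|]];
  by apply: cls_eq => t _ /=; rewrite !mu_zsec.
Qed.

Lemma pi1_mu_bij : bijective (pi1_map (R := R) muc hb).
Proof.
have /boolp.choice[h hK] := pi1_mu_surj.
by exists h => // a; apply: pi1_mu_inj; rewrite hK.
Qed.

End Main.

(** * The theorem *)

Theorem theorem6p3 (R : realType) (n : nat) (B : manifold_with_corners R n)
    (P : principal_bundle n B) (X : closed_manifold R (n * 2))
    (T : twisted_toric P X) (b : B) (y0 : assoc_torus R P)
    (b_interior : stratum B n b) (y0_fiber : assoc_proj y0 = b)
    (has_corner : stratum B 0 !=set0) :
  group_isomorphism
    (@pi1_map R X B (mu T) (nu T y0) b (@mu_continuous _ _ _ _ _ T)
      (mu_nu_base T y0_fiber)).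
Proof.
have [b0 [c [ac cb card_zero]]] := has_corner.
have c0 : Defs.coord c b0 = 0.
  have /setP zero_all : [set i | Defs.coord c b0 ord0 i == 0]%SET = [set: 'I_n]%SET.
    apply/eqP; rewrite eqEcard finset.subsetT cardsT card_ord /=.
    by rewrite -[X in (X <= _)%N]card_zero addn0.
  by apply/rowP => i; have := zero_all i; rewrite !inE mxE => /eqP.
have [U [xi0 [eps [phiX [gX [phiB [gB [s [C dB]]]]]]]]] := toric_chart_ex T b0.
have xi00 := diffeo_corner ac cb c0 (tc_mem C) (tc_center C) dB.
rewrite {}xi00 in C dB.
have Hc := contractible_all (contractible_corner C).
by split; [exact: pi1_mu_bij|exact: pi1_mapM].
Qed.
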